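(* Let $G$ be a word-representable split graph. Then $\mathcal{R}(G)=3$ if and only if $G$ contains an induced subgraph isomorphic to a graph in $\mathcal{C}_3$, i.e. to $F_0$, to an even $k$-sun for some even $k\ge4$, or to $F_1(k)$ or $F_2(k)$ for some odd $k\ge5$.
   Context: A split graph is a graph whose vertex set can be partitioned into a clique and an independent set. A graph $G=(V,E)$ is word-representable if there is a word $w$ over $V$ (a finite sequence of elements of $V$) such that for all distinct $a,b\in V$, $ab\in E$ iff $a$ and $b$ alternate in $w$ (i.e. the subsequence of $w$ formed by all occurrences of $a$ and $b$ is $abab\cdots$ or $baba\cdots$). A word is $k$-uniform if each letter occurs exactly $k$ times; $\mathcal{R}(G)$ is the least $k$ such that a $k$-uniform word represents $G$. The graphs (split graphs with clique $C$, independent set $I$, and listed neighbourhoods): $F_0$: $C=\{0,c_1,c_2,c_3,c_4\}$, $I=\{a_1,a_2,a_3\}$, $N(a_1)=\{0,c_2,c_3\}$, $N(a_2)=\{0,c_3,c_4\}$, $N(a_3)=\{0,c_1,c_4\}$. Even $k$-sun ($k\ge4$ even): $C=\{c_1,\dots,c_k\}$, $I=\{a_1,\dots,a_k\}$, $N(a_i)=\{c_i,c_{i+1}\}$ ($1\le i\le k-1$), $N(a_k)=\{c_1,c_k\}$. $F_1(k)$ ($k\ge5$ odd): $C=\{c_1,\dots,c_{k-1}\}$, $I=\{b_1,b_2,a_1,\dots,a_{k-2}\}$, $N(b_1)=\{c_1,\dots,c_{k-2}\}$, $N(b_2)=\{c_2,\dots,c_{k-1}\}$, $N(a_i)=\{c_i,c_{i+1}\}$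 ($1\le i\le k-2$). $F_2(k)$ ($k\ge5$ odd): $C=\{c_1,\dots,c_k\}$, $I=\{b,a_1,\dots,a_{k-1}\}$, $N(b)=\{c_2,\dots,c_{k-1}\}$, $N(a_i)=\{c_i,c_{i+1}\}$ ($1\le i\le k-1$). $\mathcal{C}_3$ is the family of all these graphs. *)

(* Defs.v *)
(* finite simple graphs as symmetric irreflexive relations on a finType. *)
From mathcomp Require Import all_boot.
Set Implicit Arguments. Unset Strict Implicit. Unset Printing Implicit Defensive.

Section Graphs.
Variable T : finType.

Definition alternate (a b : T) (w : seq T) : Prop :=
  let s := [seq x <- w | (x == a) || (x == b)] in
  forall i, i.+1 < size s -> nth a s i != nth a s i.+1.

Definition represents (e : rel T) (w : seq T) : Prop :=
  forall a b : T, a != b -> (e a b <-> alternate a b w).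

Definition word_representable (e : rel T) : Prop :=
  exists w : seq T, (forall x : T, x \in w) /\ represents e w.

Definition uniform (k : nat) (w : seq T) : Prop :=
  forall x : T, count_mem x w = k.

Definition k_representable (e : rel T) (k : nat) : Prop :=
  exists w : seq T, uniform k w /\ represents e w.

Definition rep_number_is (e : rel T) (k : nat) : Prop :=
  0 < k /\ k_representable e k /\ (forall j, 0 < j < k -> ~ k_representable e j).

Definition is_split (e : rel T) : Prop :=
  exists C I : {set T},
    [/\ C :&: I = set0, C :|: I = setT,
        (forall x y, x \in C -> y \in C -> x != y -> e x y) &
        (forall x y, x \in I -> y \in I -> ~~ e x y)].

Definition contains_induced (e : rel T) (T' : finType) (e' : rel T') : Prop :=
  exists f : T' -> T, injective f /\ forall x y : T', e (f x) (f y) = e' x y.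

End Graphs.

(* Generic split graph: clique vertices 0..m-1, independent vertices m+j
   (j < size nbs), with N(m+j) = the clique vertices listed in nth [::] nbs j. *)
Definition split_adj (m : nat) (nbs : seq (seq nat)) (x y : nat) : bool :=
  if x < m then (if y < m then true else x \in nth [::] nbs (y - m))
  else (if y < m then y \in nth [::] nbs (x - m) else false).

Definition split_rel (m : nat) (nbs : seq (seq nat)) : rel 'I_(m + size nbs) :=
  fun x y => (x != y) && split_adj m nbs x y.
Arguments split_rel m nbs : clear implicits.

(* F_0 : clique {0,c1,c2,c3,c4} = {0,1,2,3,4}; a1,a2,a3 *)
Definition F0_nbs : seq (seq nat) := [:: [:: 0; 2; 3]; [:: 0; 3; 4]; [:: 0; 1; 4]].
Definition F0 := split_rel 5 F0_nbs.

(* even k-sun : c_i = i-1; N(a_i) = {c_i, c_{i+1}}, N(a_k) = {c_1, c_k} *)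
Definition sun_nbs (k : nat) : seq (seq nat) := [seq [:: i; (i.+1) %% k] | i <- iota 0 k].
Definition even_sun (k : nat) := split_rel k (sun_nbs k).

(* F_1(k) : clique c_1..c_{k-1} = 0..k-2; b1, b2, a_1..a_{k-2} *)
Definition F1_nbs (k : nat) : seq (seq nat) :=
  iota 0 (k - 2) :: iota 1 (k - 2) :: [seq [:: i; i.+1] | i <- iota 0 (k - 2)].
Definition F1 (k : nat) := split_rel (k - 1) (F1_nbs k).

(* F_2(k) : clique c_1..c_k = 0..k-1; b, a_1..a_{k-1} *)
Definition F2_nbs (k : nat) : seq (seq nat) :=
  iota 1 (k - 2) :: [seq [:: i; i.+1] | i <- iota 0 (k - 1)].
Definition F2 (k : nat) := split_rel k (F2_nbs k).
Arguments even_sun k : clear implicits.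
Arguments F1 k : clear implicits.
Arguments F2 k : clear implicits.

(* Main.v *)
(** A word w orders its letters by comparing the number of occurrences in every
    prefix; two letters alternate exactly when these numbers differ by at most
    one in one direction.  Hence x <= y <= z <= t and x ~ t force y ~ z.  On a
    split graph this makes the clique a linear order 1, ..., m, and every
    neighbourhood an arc of the circle Z/m: an interval, or the complement of
    one, with no two arcs overlapping at both ends.

    Such a structure always yields a 3-uniform word.  In a 2-uniform word the
    clique is a pencil of m diameters and an independent vertex is a chord, that
    is, one of the two lifts of its arc to the double cover Z/2m.  Two arcs that
    overlap must receive lifts that do not cross, which is a system of parity
    constraints.  If it is solvable, the chords give a 2-uniform word.

    Otherwise take a shortest unbalanced cycle of n overlapping arcs and lift it
    to the line Z, where it closes up after t turns, with t odd iff n is even.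
    By minimality arcs not consecutive on the cycle do not overlap, so they are
    nested or disjoint.  If a lift lies inside a lift b of another arc, so do the
    next ones along the cycle, in both directions, until a neighbour of b is
    reached; so nesting forces t = 0.
    If t <> 0, non-consecutive arcs are disjoint and the cycle is an even sun.
    If t = 0, then n = 3 gives F_0, and for n >= 5 there is an arc containing
    all those not consecutive to it; one or two such arcs give F_2 or F_1.

    Conversely, in a 2-uniform word for a graph of the family the arcs of
    consecutive vertices a_i must advance by k + 1 or by k - 1 modulo 2k, always
    in the same direction, and going around produces a crossing. *)
From Stdlib Require Import ZArith.
Require Import Defs.
From mathcomp Require Import all_boot zify.
Set Implicit Arguments. Unset Strict Implicit. Unset Printing Implicit Defensive.

(** * Prefix counts, alternation, and words given by positions *)

Definition dominates (T : eqType) (a b : T) (w : seq T) : Prop :=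
  forall n, count_mem b (take n w) <= count_mem a (take n w).

Definition interlaces (T : eqType) (a b : T) (w : seq T) : Prop :=
  forall n, count_mem b (take n w) <= count_mem a (take n w)
            <= (count_mem b (take n w)).+1.

(** Deleting a leading [a] leaves a word that must interlace [b] before [a], so the induction runs
    over both letters at once. The default [a] of [head] accepts a word without either letter. *)
Lemma interlaces_filter (T : eqType) (a b : T) (w : seq T) : a != b ->
  let s := [seq x <- w | (x == a) || (x == b)] in
  interlaces a b w <-> sorted (fun x y => x != y) s && (head a s != b).
Proof.
elim: w a b => [|x w IH] a b ab /=.
  by split => // _ n; rewrite leqnn leqnSn.
have ba : b != a by rewrite eq_sym.
have orE : [seq x <- w | (x == b) || (x == a)] = [seq x <- w | (x == a) || (x == b)].
  by apply: eq_filter => y; rewrite orbC.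
case: (eqVneq x a) => [->|xa] /=.
  have [IH1 IH2] := IH b a ba; rewrite orE in IH1 IH2.
  have -> : path (fun x y => x != y) a [seq x <- w | (x == a) || (x == b)] =
     (sorted (fun x y => x != y) [seq x <- w | (x == a) || (x == b)]) &&
     (head b [seq x <- w | (x == a) || (x == b)] != a).
    case: [seq x <- w | _] => [|y s] /=; first by rewrite ba.
    by rewrite andbC eq_sym.
  rewrite ab andbT; split => [h|h].
    by apply: IH1 => n; have := h n.+1; rewrite /= eqxx (negbTE ab) /=; lia.
  by case=> [|n] //=; rewrite eqxx (negbTE ab); have := IH2 h n; lia.
case: (eqVneq x b) => [->|xb] /=.
  rewrite eqxx andbF; split => // /(_ 1) /=.
  by rewrite take0 /= eqxx (negbTE ba).
have [IH1 IH2] := IH a b ab; split => [h|h].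
  by apply: IH1 => n; have := h n.+1; rewrite /= (negbTE xa) (negbTE xb).
by case=> [|n] //=; rewrite (negbTE xa) (negbTE xb); apply: IH2.
Qed.

Lemma alternate_interlaces (T : finType) (a b : T) (w : seq T) : a != b ->
  alternate a b w <-> interlaces a b w \/ interlaces b a w.
Proof.
move=> ab; have ba : b != a by rewrite eq_sym.
have := interlaces_filter w ab; have := interlaces_filter w ba.
have -> : [seq x <- w | (x == b) || (x == a)] = [seq x <- w | (x == a) || (x == b)].
  by apply: eq_filter => y; rewrite orbC.
rewrite /alternate; set s := [seq x <- w | _] => /= -> ->.
have E : (forall i, i.+1 < size s -> nth a s i != nth a s i.+1) <->
         sorted (fun x y => x != y) s.
  by split => [h|/(sortedP a)] //; apply/(sortedP a).
rewrite E; split; last by case=> /andP[].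
move=> so; rewrite so !andTb; case: s {E so} => [|y s] /=; first by left.
by case: (eqVneq y b) => [->|_]; [right | left].
Qed.

Lemma take_pmap (S T : eqType) (f : S -> option T) (s : seq S) n :
  exists t, take n (pmap f s) = pmap f (take t s).
Proof.
elim: s n => [|x s IH] n /=; first by exists 0.
case E : (f x) => [y|] /=.
  case: n => [|n]; first by exists 0.
  by have [t ht] := IH n; exists t.+1; rewrite /= E /= ht.
by have [t ht] := IH n; exists t.+1; rewrite /= E /= ht.
Qed.

Lemma pmap_take (S T : eqType) (f : S -> option T) (s : seq S) t :
  exists n, pmap f (take t s) = take n (pmap f s).
Proof.
exists (size (pmap f (take t s))).
by rewrite -{3}(cat_take_drop t s) pmap_cat take_size_cat.
Qed.

(** A copy of [x] sits at each position [K x i] and the word lists the letters by position. Its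
    prefixes correspond to thresholds [t], so interlacing compares numbers of keys below [t]. *)
Lemma key_word (T : finType) k (K : T -> 'I_k -> nat) :
  (forall x y i j, K x i = K y j -> x = y /\ i = j) ->
  exists w : seq T, uniform k w /\
    forall x y, interlaces x y w <->
      forall t, \sum_(i < k) (K y i < t) <= \sum_(i < k) (K x i < t)
                <= (\sum_(i < k) (K y i < t)).+1.
Proof.
move=> Kinj.
(* [f t] is the letter at position [t], or [None] in a gap; [pmap] drops the gaps. *)
pose f t := omap fst [pick xi : T * 'I_k | K xi.1 xi.2 == t].
have fE t x : (f t == Some x) = [exists i, K x i == t].
  rewrite /f; case: pickP => [[y j] /= /eqP e|h] /=.
    apply/eqP/existsP => [[<-]|[i /eqP e']]; first by exists j; apply/eqP.
    by have [->] := Kinj y x j i (etrans e (esym e')).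
  by apply/eqP/existsP => // -[i e]; have := h (x, i); rewrite /= e.
have cnt t x : count_mem x (pmap f (iota 0 t)) = \sum_(i < k) (K x i < t).
  elim: t => [|t IH]; first by rewrite big1.
  rewrite -addn1 iotaD pmap_cat count_cat IH /= add0n.
  have -> : count_mem x (oapp (cons^~ [::]) [::] (f t)) = (f t == Some x).
    by case: (f t) => //= y; rewrite addn0.
  rewrite fE.
  have -> : [exists i, K x i == t] = \sum_(i < k) (K x i == t) :> nat.
    case: existsP => [[i /eqP e]|h].
      rewrite (bigD1 i) //= e eqxx big1 ?addn0 // => j ij.
      case: eqP => // e'; have [_ /eqP] := Kinj x x j i (etrans e' (esym e)).
      by rewrite (negbTE ij).
    by rewrite big1 // => i _; case: eqP => // e; case: h; exists i; apply/eqP.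
  rewrite -big_split; apply: eq_bigr => i _ /=; lia.
pose N := (\max_(x : T) \max_(i < k) K x i).+1.
have KN x i : K x i < N.
  rewrite ltnS; apply: leq_trans (leq_bigmax x).
  exact: (@leq_bigmax _ (fun i => K x i)).
exists (pmap f (iota 0 N)); split.
  move=> x; rewrite cnt.
  under eq_bigr do rewrite KN.
  by rewrite sum1_card card_ord.
move=> x y; split=> [h t|h n].
  have [tN|Nt] := leqP t N.
    have [n e] := pmap_take f (iota 0 N) t.
    have := h n; rewrite -e take_iota (minn_idPl tN) !cnt; exact.
  have [n e] := pmap_take f (iota 0 N) N.
  have := h n; rewrite -e take_iota minnn !cnt.
  have S z : \sum_(i < k) (K z i < N) = \sum_(i < k) (K z i < t).
    by apply: eq_bigr => i _; rewrite KN (ltn_trans (KN _ _) Nt).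
  by rewrite !S.
have [t ->] := take_pmap f (iota 0 N) n.
by rewrite take_iota !cnt.
Qed.

(** A letter occurring twice is a chord with ends [p] and [q]; alternation is crossing. *)
Lemma two_uniform_keys (T : finType) (p q : T -> nat) :
  (forall x, p x < q x) ->
  (forall x y, p x = p y \/ q x = q y -> x = y) ->
  (forall x y, p x <> q y) ->
  exists w : seq T, uniform 2 w /\
    forall x y, x != y -> (alternate x y w <->
       (p x < p y < q x /\ q x < q y) \/ (p y < p x < q y /\ q y < q x)).
Proof.
move=> pq inj1 inj2.
pose K (x : T) (i : 'I_2) := if i == 0 :> nat then p x else q x.
have [x y i j|w [uw hw]] := @key_word T 2 K.
  rewrite /K; case: i => [[|[|//]] hi]; case: j => [[|[|//]] hj] //= e.
  - by rewrite (inj1 x y) //; [split=> //; apply: val_inj | left].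
  - by case: (inj2 _ _ e).
  - by case: (inj2 _ _ (esym e)).
  - by rewrite (inj1 x y) //; [split=> //; apply: val_inj | right].
exists w; split => // x y xy; rewrite alternate_interlaces // !hw.
have E z t : \sum_(i < 2) (K z i < t) = (p z < t) + (q z < t).
  by rewrite !big_ord_recl big_ord0 addn0.
have F a b : a != b -> (forall t, \sum_(i < 2) (K b i < t) <= \sum_(i < 2) (K a i < t)
     <= (\sum_(i < 2) (K b i < t)).+1) <-> p a < p b < q a /\ q a < q b.
  move=> ab; split=> [h|h t].
  - have := h (p a).+1; have := h (p b).+1; have := h (q a).+1; have := h (q b).+1.
    rewrite !E; have := pq a; have := pq b; have := inj2 a b; have := inj2 b a.
    have : p a <> p b by move=> e; move/eqP: ab; apply; apply: inj1; left.
    have : q a <> q b by move=> e; move/eqP: ab; apply; apply: inj1; right.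
    lia.
  - rewrite !E; lia.
by rewrite !F // eq_sym.
Qed.

Lemma three_uniform_keys (T : finType) (p q r : T -> nat) :
  (forall x, p x < q x < r x) ->
  (forall x y, p x = p y \/ q x = q y \/ r x = r y -> x = y) ->
  (forall x y, [/\ p x <> q y, p x <> r y & q x <> r y]) ->
  exists w : seq T, uniform 3 w /\
    forall x y, x != y -> (alternate x y w <->
       (p x < p y < q x /\ q x < q y < r x /\ r x < r y) \/
       (p y < p x < q y /\ q y < q x < r y /\ r y < r x)).
Proof.
move=> pqr inj1 inj2.
pose K (x : T) (i : 'I_3) := if i == 0 :> nat then p x else if i == 1 :> nat then q x else r x.
have [x y i j|w [uw hw]] := @key_word T 3 K.
  have [a1 a2 a3] := inj2 x y; have [b1 b2 b3] := inj2 y x; rewrite /K.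
  case: i => [[|[|[|//]]] hi]; case: j => [[|[|[|//]]] hj] //= e;
   try (by exfalso; congruence); rewrite (inj1 x y) //;
   try (by split=> //; apply: val_inj); tauto.
exists w; split => // x y xy; rewrite alternate_interlaces // !hw.
have E z t : \sum_(i < 3) (K z i < t) = (p z < t) + (q z < t) + (r z < t).
  by rewrite !big_ord_recl big_ord0 addn0 addnA.
have F a b : a != b -> (forall t, \sum_(i < 3) (K b i < t) <= \sum_(i < 3) (K a i < t)
     <= (\sum_(i < 3) (K b i < t)).+1) <->
     (p a < p b < q a /\ q a < q b < r a /\ r a < r b).
  move=> ab; split=> [h|h t].
  - have [nqp _ _] := inj2 b a; have [npq _ nqr] := inj2 a b.
    have [_ _ nrq] := inj2 b a; move: (pqr a) (pqr b) => ha hb.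
    have np : p a <> p b by move=> e; move/eqP: ab; apply; apply: inj1; tauto.
    have nq : q a <> q b by move=> e; move/eqP: ab; apply; apply: inj1; tauto.
    have nr : r a <> r b by move=> e; move/eqP: ab; apply; apply: inj1; tauto.
    have h1 : p a < p b by have := h (p b).+1; rewrite !E; clear -np ha hb; lia.
    have h2 : q a < q b by have := h (q b).+1; rewrite !E; clear -nq ha hb; lia.
    have h3 : r a < r b by have := h (r b).+1; rewrite !E; clear -nr ha hb; lia.
    have h4 : p b < q a by have := h (q a).+1; rewrite !E; clear -nqp ha hb; lia.
    have h5 : q b < r a by have := h (r a).+1; rewrite !E; clear -nrq ha hb; lia.
    by rewrite h1 h2 h3 h4 h5.
  - rewrite !E; case: h => /andP[h1 h2] [/andP[h3 h4] h5].
    case: (ltnP (p a) t) => k1; case: (ltnP (p b) t) => k2;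
    case: (ltnP (q a) t) => k3; case: (ltnP (q b) t) => k4;
    case: (ltnP (r a) t) => k5; case: (ltnP (r b) t) => k6 //; exfalso; lia.
by rewrite !F // eq_sym.
Qed.

(** * The circular structure of word-representable split graphs *)

(** The arc of [a] is the interval [(l a, r a]], or its complement if [wrap a]; a non-wrapping arc
    with [l a = r a] is empty. The last two fields forbid two arcs to overlap at both ends. *)
Record split_model (T : finType) (e : rel T) (C : {set T})
    (idx : T -> nat) (wrap : T -> bool) (l r : T -> nat) : Prop := SplitModel {
  sm_idx : forall c, c \in C -> 0 < idx c <= #|C|;
  sm_inj : {in C &, injective idx};
  sm_ends : forall a, a \notin C -> l a <= r a <= #|C|;
  sm_nb0 : forall a c, a \notin C -> c \in C -> wrap a = false ->
             e a c = (l a < idx c <= r a);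
  sm_wrap : forall a, a \notin C -> wrap a -> 0 < l a /\ r a < #|C|;
  sm_nb1 : forall a c, a \notin C -> c \in C -> wrap a ->
             e a c = (idx c <= l a) || (r a < idx c);
  sm_inner : forall a b, a \notin C -> b \notin C -> wrap a = false -> wrap b ->
             ~ (l a < l b /\ r b < r a);
  sm_meet : forall a b, a \notin C -> b \notin C -> wrap a -> wrap b -> l a <= r b }.

Lemma index_surj (T : finType) (C : {set T}) (idx : T -> nat) :
  (forall c, c \in C -> 0 < idx c <= #|C|) -> {in C &, injective idx} ->
  forall k, 0 < k <= #|C| -> exists2 c, c \in C & idx c = k.
Proof.
move=> rng inj k hk.
have u : uniq (map idx (enum C)).
  by rewrite map_inj_in_uniq ?enum_uniq // => x y; rewrite !mem_enum; apply: inj.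
have [|| _ E] := uniq_min_size u (s2 := iota 1 #|C|).
- by move=> x /mapP[c]; rewrite mem_enum => /rng h ->; rewrite mem_iota; lia.
- by rewrite size_map size_iota -cardE.
have : k \in map idx (enum C) by rewrite E mem_iota; lia.
by case/mapP=> c; rewrite mem_enum => cC ->; exists c.
Qed.

Section OrderToModel.
Variables (T : finType) (e D : rel T) (C : {set T}).
Hypotheses (Hsym : symmetric e) (Hclq : {in C &, forall x y, x != y -> e x y})
  (Hind : forall x y, x \notin C -> y \notin C -> ~~ e x y).
Hypotheses (Drefl : reflexive D) (Dtrans : transitive D)
  (Danti : antisymmetric D) (Dcomp : forall x y, e x y -> D x y || D y x)
  (Dsemi : forall x y z t, D x y -> D y z -> D z t -> e x t -> y != z -> e y z).

(** [D] will be dominance between letters. It is total on the clique, and [idx] is the rank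
    there. *)
Let idx c := #|[set c' in C | D c' c]|.

Let idx_le c c' : c \in C -> c' \in C -> D c c' = (idx c <= idx c').
Proof.
move=> cC c'C; apply/idP/idP => [h|].
  apply: subset_leq_card; apply/subsetP => x; rewrite !inE => /andP[-> /=].
  by move=> h'; apply: Dtrans h.
apply: contraTT => nD.
have h : D c' c.
  have : c != c' by apply: contraNneq nD => ->.
  by move/(Hclq cC c'C)/Dcomp; rewrite (negbTE nD).
rewrite -ltnNge; apply: proper_card; apply/properP; split.
  by apply/subsetP => x; rewrite !inE => /andP[-> /=] h'; apply: Dtrans h.
by exists c; rewrite !inE cC ?Drefl.
Qed.

Let neqC a c : a \notin C -> c \in C -> c != a.
Proof. by move=> aC cC; apply: contraNneq aC => <-. Qed.

(** Besides the arc, this records on which side of [a] its neighbours lie in [D]: all on one side if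
    the arc does not wrap, the first ones below and the last ones above if it does. The exclusion of
    double overlaps rests on this. *)
Let placement a (t : bool * nat * nat) : Prop :=
  let: (wrap, l, r) := t in [/\ l <= r <= #|C|,
   wrap = false -> (forall c, c \in C -> e a c = (l < idx c <= r)) /\
      ((forall c, c \in C -> e a c -> D c a) \/ (forall c, c \in C -> e a c -> D a c)) &
   wrap = true -> [/\ 0 < l, r < #|C|,
      (forall c, c \in C -> e a c = (idx c <= l) || (r < idx c)),
      (forall c, c \in C -> idx c <= l -> D c a) &
      (forall c, c \in C -> r < idx c -> D a c)]].

Let idx_rng c : c \in C -> 0 < idx c <= #|C|.
Proof.
move=> cC; apply/andP; split.
  by apply/card_gt0P; exists c; rewrite !inE cC Drefl.
by apply: subset_leq_card; apply/subsetP => x; rewrite !inE => /andP[].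
Qed.

Let idx_inj : {in C &, injective idx}.
Proof.
by move=> c c' cC c'C ee; apply: Danti; rewrite !idx_le // ee leqnn.
Qed.

(** If all neighbours lie on one side of [a], semi-transitivity makes them an interval. Otherwise
    those below form an initial segment and those above a final one: if [c'] is below [a] and [a]
    below a neighbour [d], the clique edge between [c'] and [d] forces one between [c'] and [a]. *)
Let place a : a \notin C -> exists t, placement a t.
Proof.
move=> aC; have ne := neqC aC.
pose In c := [&& c \in C, e a c & D c a]; pose Out c := [&& c \in C, e a c & D a c].
have In_Out c : c \in C -> e a c -> In c || Out c.
  by move=> cC ac; rewrite /In /Out cC ac /= orbC Dcomp.
have conv x c y : x \in C -> c \in C -> y \in C -> e a x -> e a y ->
    idx x <= idx c <= idx y -> (D x a && D y a) || (D a x && D a y) -> e a c.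
  move=> xC cC yC ax ay; rewrite -!idx_le // => /andP[xc cy].
  case/orP=> /andP[h1 h2].
    rewrite Hsym; apply: (Dsemi xc _ (Drefl a)); rewrite ?(Hsym x) ?ne //.
    exact: Dtrans h2.
  apply: (Dsemi (Drefl a) _ cy); rewrite // 1?eq_sym ?ne //.
  exact: Dtrans xc.
have homog : ((forall c, c \in C -> e a c -> D c a) \/
              (forall c, c \in C -> e a c -> D a c)) -> exists t, placement a t.
  move=> hom.
  have [c0 /andP[c0C ac0]|none] := pickP (fun c => (c \in C) && e a c); last first.
    exists (false, 0, 0); split=> // _; split=> // c cC.
    by have := none c; rewrite /= cC /= => ->; lia.
  have c0P : (c0 \in C) && e a c0 by rewrite c0C.
  have [x /andP[xC ax] xmin] := @arg_minnP _ c0 (fun c => (c \in C) && e a c) idx c0P.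
  have [y /andP[yC ay] ymax] := @arg_maxnP _ c0 (fun c => (c \in C) && e a c) idx c0P.
  exists (false, (idx x).-1, idx y); split=> //.
    by have := idx_rng xC; have := idx_rng yC; have := ymax x; rewrite xC ax /=; lia.
  move=> _; split=> // c cC; have px := idx_rng xC; apply/idP/idP => [ac|h].
    have /xmin h1 : (c \in C) && e a c by rewrite cC.
    have /ymax h2 : (c \in C) && e a c by rewrite cC.
    by clear -h1 h2 px; lia.
  apply: (conv x c y) => //; first by lia.
  by case: hom => hom; rewrite !hom // orbT.
have [c0 c0P|none] := pickP In; last first.
  apply: homog; right=> c cC ac; have := In_Out c cC ac.
  by rewrite none => /and3P[].
have [d0 d0P|none] := pickP Out; last first.
  apply: homog; left=> c cC ac; have := In_Out c cC ac.
  by rewrite none orbF => /and3P[].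
have nIO c d : In c -> Out d -> idx c < idx d.
  case/and3P=> cC ac ca /and3P[dC ad da]; rewrite ltnNge -idx_le //.
  apply/negP => dc; have := Dtrans da dc => ac'.
  by have /eqP := ne _ cC; apply; apply: Danti; rewrite ca ac'.
have down c c' : In c -> c' \in C -> idx c' <= idx c -> In c'.
  move=> Ic c'C le; have /and3P[cC ac ca] := Ic.
  have c'c : D c' c by rewrite idx_le.
  have c'a := Dtrans c'c ca; rewrite /In c'C c'a andbT /= Hsym.
  have /and3P[dC ad da] := d0P.
  apply: (Dsemi (Drefl c') c'a da); last exact: ne.
  apply: Hclq => //; apply: contraTneq (nIO _ _ Ic d0P) => <-.
  by rewrite -leqNgt.
have up c c' : Out c -> c' \in C -> idx c <= idx c' -> Out c'.
  move=> Oc c'C le; have /and3P[cC ac ca] := Oc.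
  have cc' : D c c' by rewrite idx_le.
  have ac' := Dtrans ca cc'; rewrite /Out c'C ac' andbT /=.
  have /and3P[dC ad da] := c0P.
  apply: (Dsemi da ac' (Drefl c')); last by rewrite eq_sym ne.
  apply: Hclq => //; apply: contraTneq (nIO _ _ c0P Oc) => ->.
  by rewrite -leqNgt.
have [x xP xmax] := @arg_maxnP _ c0 In idx c0P.
have [y yP ymin] := @arg_minnP _ d0 Out idx d0P.
have xC : x \in C by case/and3P: xP.
have yC : y \in C by case/and3P: yP.
have xy := nIO _ _ xP yP; have rx := idx_rng xC; have ry := idx_rng yC.
have le_In c : c \in C -> idx c <= idx x -> In c by move=> cC; apply: down.
have gt_Out c : c \in C -> (idx y).-1 < idx c -> Out c.
  by move=> cC h; apply: up yP _ _ => //; lia.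
exists (true, idx x, (idx y).-1); split=> //; first by lia.
move=> _; split; first by lia.
- by lia.
- move=> c cC; apply/idP/idP => [ac|/orP[/(le_In _ cC)|/(gt_Out _ cC)] /and3P[] //].
  case/orP: (In_Out _ cC ac) => [/xmax h|/ymin h]; apply/orP; first by left.
  by right; clear -h ry; lia.
- by move=> c cC /(le_In _ cC) /and3P[].
- by move=> c cC /(gt_Out _ cC) /and3P[].
Qed.

Lemma model_of_order : exists idx wrap l r, split_model e C idx wrap l r.
Proof.
have [f hf] : exists f, forall a, a \notin C -> placement a (f a).
  apply: (@fin_all_exists _ _ (fun a t => a \notin C -> placement a t)) => a.
  have [aC|aC] := boolP (a \in C); first by exists (true, 0, 0).
  by have [t ht] := place aC; exists t.
have surj := index_surj idx_rng idx_inj.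
exists idx, (fun a => (f a).1.1), (fun a => (f a).1.2), (fun a => (f a).2).
split=> //.
- by move=> a /hf; case: (f a) => [[w l] r] [].
- by move=> a c /hf; case: (f a) => [[w l] r] [_ h0 _] cC /= /h0[-> ].
- by move=> a /hf; case: (f a) => [[w l] r] [_ _ h1] /= /h1[].
- by move=> a c /hf; case: (f a) => [[w l] r] [_ _ h1] cC /= /h1[_ _ ->].
(* An interval that sticks out of the gap of [b] on both sides has its first vertex [x] below [b]
   and its last vertex [y] above [b]. Whichever side of its neighbours [a] is on, semi-transitivity
   would join [a] to [b]. *)
- move=> a b aC bC wa wb.
  have ab : b != a by apply: contraTneq wb => ->; rewrite wa.
  move: wa wb; have := hf a aC; have := hf b bC.
  case: (f a) => [[wa la] ra]; case: (f b) => [[wb lb] rb] /= [hb _ h1] [ha h0 _].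
  move=> /h0 [nba mono] /h1[lb0 rbm nbb Db bD] [ll rr].
  have [x xC ix] : exists2 c, c \in C & idx c = la.+1 by apply: surj; clear -ll rr hb ha; lia.
  have [c cC ic] : exists2 c, c \in C & idx c = lb by apply: surj; clear -ll rr hb ha; lia.
  have [d dC id] : exists2 c, c \in C & idx c = rb.+1 by apply: surj; clear -ll rr hb ha; lia.
  have [y yC iy] : exists2 c, c \in C & idx c = ra by apply: surj; clear -ll rr hb ha; lia.
  have xb : D x b by apply: Dtrans (Db c cC _); rewrite ?idx_le // ?ix ic.
  have yb : D b y by apply: (Dtrans (bD d dC _)); rewrite ?idx_le // id ?iy.
  have lr : la < ra by clear -ll rr hb; lia.
  have ax : e a x by rewrite nba // ix leqnn lr.
  have ay : e a y by rewrite nba // iy leqnn lr.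
  case: mono => mono.
    have := Dsemi xb (Dtrans yb (mono y yC ay)) (Drefl a).
    by rewrite Hsym ax => /(_ isT ab); apply/negP; apply: Hind.
  have := Dsemi (Drefl a) (Dtrans (mono x xC ax) xb) yb ay.
  by rewrite eq_sym ab => /(_ isT); apply/negP; apply: Hind.
(* If [r b < l a], the clique vertex of index [l a] is above [b] and below [a]. Then [b] and [a] lie
   between the first and the last clique vertices, which are adjacent. *)
- move=> a b aC bC wa wb; rewrite leqNgt; apply/negP => lt.
  have ab : b != a.
    apply: contraTneq lt => ->; rewrite -leqNgt.
    by have := hf a aC; case: (f a) => [[? ?] ?] [/andP[]].
  move: wa wb lt; have := hf a aC; have := hf b bC.
  case: (f a) => [[wa la] ra]; case: (f b) => [[wb lb] rb] /= [hb _ h1] [ha _ h0].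
  move=> /h0 [la0 ram nba Da aD] /h1[lb0 rbm nbb Db bD] lt.
  have [c cC ic] : exists2 c, c \in C & idx c = la by apply: surj; clear -la0 lt ha; lia.
  have ba : D b a by apply: (Dtrans (bD c cC _)); rewrite ?Da // ic.
  have [x xC ix] : exists2 c, c \in C & idx c = 1 by apply: surj; clear -rbm; lia.
  have [y yC iy] : exists2 c, c \in C & idx c = #|C| by apply: surj; clear -rbm; lia.
  have xy : e x y by apply: Hclq => //; apply/eqP => E; move: ix iy; rewrite E; clear -la0 lt ram
      ha; lia.
  have := Dsemi (Db x xC _) ba (aD y yC _) xy ab; rewrite ix iy lb0 ram.
  by move/(_ isT isT); apply/negP; apply: Hind.
Qed.

End OrderToModel.

(** The order is dominance. If the counts of four letters never increase from each to the next, and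
    the outer two differ by at most one in each prefix, so do the inner two: this is
    semi-transitivity. *)
Theorem word_representable_model (T : finType) (e : rel T) (C : {set T}) :
  symmetric e -> irreflexive e -> word_representable e ->
  {in C &, forall x y, x != y -> e x y} ->
  (forall x y, x \notin C -> y \notin C -> ~~ e x y) ->
  exists idx wrap l r, split_model e C idx wrap l r.
Proof.
move=> Hsym Hirr [w [occ rep]] Hclq Hind.
pose D x y := [forall n : 'I_(size w).+1, count_mem y (take n w) <= count_mem x (take n w)].
have DP x y : reflect (dominates x y w) (D x y).
  apply: (iffP forallP) => [h n|h n]; last exact: h.
  have [lt|ge] := ltnP n (size w).+1; first exact: (h (Ordinal lt)).
  by have := h ord_max; rewrite take_size take_oversize // ltnW.
apply: (@model_of_order T e D C) => //.
- by move=> x; apply/DP.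
- by move=> y x z /DP h1 /DP h2; apply/DP => n; apply: leq_trans (h1 n).
(* Equal counts in all prefixes fail just after the first [x], which exists since every letter
   occurs. *)
- move=> x y /andP[/DP h1 /DP h2]; apply/eqP/negPn/negP => xy.
  have E n : count_mem x (take n w) = count_mem y (take n w).
    by apply/eqP; rewrite eqn_leq h1 h2.
  have yw := E (index x w).+1; have yv := E (index x w).
  have lt : index x w < size w by rewrite index_mem.
  move: yw; rewrite (take_nth x lt) -cats1 !count_cat yv /= nth_index // eqxx.
  by rewrite (negbTE xy); lia.
- move=> x y exy; have xy : x != y by apply: contraTneq exy => ->; rewrite Hirr.
  have /(rep x y xy)/(alternate_interlaces w xy) [h|h] := exy.
    by apply/orP; left; apply/DP => n; case/andP: (h n).
  by apply/orP; right; apply/DP => n; case/andP: (h n).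
move=> x y z t /DP xy /DP yz /DP zt ext yz'.
have xt : x != t by apply: contraTneq ext => ->; rewrite Hirr.
apply/(rep y z yz')/(alternate_interlaces w yz'); left=> n.
have := xy n; have := yz n; have := zt n.
have /(rep x t xt)/(alternate_interlaces w xt) [h|h] := ext.
  by have := h n; lia.
by have := h n; lia.
Qed.

(** * Words built from insertion positions *)

(** Provides distinct offsets for vertices inserted at one place, compatibly with [f]. Ties are
    broken by [enum_rank], so two refinements break common ties alike. *)
Lemma rank_refining (T : finType) (f : T -> nat) :
  exists (R : nat) (rk : T -> nat), [/\ forall x, rk x < R, injective rk,
    forall x y, f x < f y -> rk x < rk y &
    forall x y, f x = f y -> (rk x < rk y) = (enum_rank x < enum_rank y)].
Proof.
exists ((\max_x f x).+1 * #|T|), (fun x => f x * #|T| + enum_rank x).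
have lt x : enum_rank x < #|T| := ltn_ord (enum_rank x).
split=> [x|x y|x y fxy|x y ->]; last by rewrite ltn_add2l.
- have h : f x <= \max_y f y := leq_bigmax x.
  apply: (@leq_trans ((f x).+1 * #|T|)); last by rewrite leq_mul2r ltnS h orbT.
  by rewrite mulSn addnC ltn_add2r.
- move/(congr1 (fun k => k %% #|T|)); rewrite !modnMDl !modn_small //.
  by move/val_inj/enum_rank_inj.
apply: (@leq_trans ((f x).+1 * #|T|)); first by rewrite mulSn addnC ltn_add2r.
by rewrite (leq_trans _ (leq_addr _ _)) // leq_mul2r fxy orbT.
Qed.

Lemma ltn_lexi q t t' o o' : o < q -> o' < q ->
  (t * q + o < t' * q + o') = (t < t') || ((t == t') && (o < o')).
Proof.
move=> oq o'q; case: (ltngtP t t') => [h|h|->] /=; last by rewrite ltn_add2l.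
  apply: (@leq_trans (t.+1 * q)); first by rewrite mulSn addnC ltn_add2r.
  by rewrite (leq_trans _ (leq_addr _ _)) // leq_mul2r h orbT.
apply/negbTE; rewrite -leqNgt ltnW //.
apply: (@leq_trans (t'.+1 * q)); first by rewrite mulSn addnC ltn_add2r.
by rewrite (leq_trans _ (leq_addr _ _)) // leq_mul2r h orbT.
Qed.

Section ThreeUniform.
Variables (T : finType) (e : rel T) (C : {set T}) (idx : T -> nat)
  (wrap : T -> bool) (l r : T -> nat).
Hypotheses (Hsym : symmetric e) (Hclq : {in C &, forall x y, x != y -> e x y})
  (Hind : forall x y, x \notin C -> y \notin C -> ~~ e x y)
  (HM : split_model e C idx wrap l r).

(* Each clique vertex occurs once in each of three copies of 1, ..., m.  All
   intervals [l b, r b] of the wrapping vertices share the point z; such a b is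
   inserted at z, l b, r b of the three copies, and a non-wrapping a at l a of
   the second copy, between the second and third copies, and at r a of the
   third.  The orders chosen among vertices inserted at the same place make any
   two independent vertices start and end with the same letter, or repeat one. *)
Theorem three_representable : k_representable e 3.
Proof.
case: HM => idxP inj ends nb0 wrapP nb1 inner meet.
set m := #|C| in idxP ends wrapP.
(* The largest left end of the gaps; [sm_meet] puts it before all right ends. *)
pose z := \max_(b | (b \notin C) && wrap b) l b.
have zP b : b \notin C -> wrap b -> l b <= z <= r b.
  move=> bC wb; apply/andP; split.
    by apply: (@leq_bigmax_cond _ (fun b => (b \notin C) && wrap b) l); rewrite bC.
  by apply/bigmax_leqP => a /andP[aC wa]; apply: meet.
have [R1 [rk [rkR rk_inj rk_mono _]]] := rank_refining l.
have [R2 [sg [sgR sg_inj sg_mono _]]] := rank_refining r.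
(* A key is [place * Q + offset]. Clique vertices have offset 0, so a vertex inserted at a place
   comes right after the clique vertex there. The copies start after 0, [m.+2] and [m.+2 + m.+2]. *)
pose R := R1 + R2; pose Q := (2 * R).+2.
have rR x : rk x < R by rewrite (leq_trans (rkR x)) ?leq_addr.
have sR x : sg x < R by rewrite (leq_trans (sgR x)) ?leq_addl.
pose tp x := if x \in C then idx x else if wrap x then z else m.+2 + l x.
(* Wrapping vertices share their first place, where they are ordered against [sg], while their last
   occurrences follow [sg]. Non-wrapping ones share their second place, ordered against the order
   [rk] of their first occurrences. *)
pose op x := if x \in C then 0 else if wrap x then R - sg x else (R + rk x).+1.
pose tq x := if x \in C then m.+2 + idx x else if wrap x then m.+2 + l x else m.+2 + m.+1.
pose oq x := if x \in C then 0 else if wrap x then (sg x).+1 else R - rk x.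
pose tr x := if x \in C then m.+2 + m.+2 + idx x else m.+2 + m.+2 + r x.
pose oo x := if x \in C then 0 else if wrap x then (R + sg x).+1 else (rk x).+1.
have opQ x : op x < Q.
  by rewrite /op /Q; have := rR x; have := sR x; clear; case: (x \in C); case: (wrap x); lia.
have oqQ x : oq x < Q.
  by rewrite /oq /Q; have := rR x; have := sR x; clear; case: (x \in C); case: (wrap x); lia.
have ooQ x : oo x < Q.
  by rewrite /oo /Q; have := rR x; have := sR x; clear; case: (x \in C); case: (wrap x); lia.
have zm x : x \notin C -> wrap x -> z <= m.
  by move=> xC /(zP x xC) /andP[_ h]; apply: leq_trans h _; case/andP: (ends x xC).
have tP x : [/\ tp x <= m.+2 + m, m.+2 <= tq x & tq x < m.+2 + m.+2].
  suff: tp x <= m.+2 + m /\ m.+2 <= tq x < m.+2 + m.+2 by case=> -> /andP[].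
  rewrite /tp /tq; case: ifP => [/idxP|/negbT xC]; first by clear; lia.
  case: ifP => [w|_]; last by move: (ends x xC); clear; lia.
  by have := zm x xC w; move: (ends x xC); clear; lia.
have eqlex t t' o o' : o < Q -> o' < Q -> t * Q + o = t' * Q + o' -> t = t' /\ o = o'.
  move=> h h' E; have := ltn_lexi t t' h h'; have := ltn_lexi t' t h' h.
  by rewrite E ltnn; clear; lia.
pose p x := tp x * Q + op x; pose q x := tq x * Q + oq x; pose s x := tr x * Q + oo x.
have trP x : m.+2 + m.+2 <= tr x by rewrite /tr; case: ifP => _; rewrite leq_addr.
have [] := @three_uniform_keys T p q s.
- move=> x; rewrite /p /q /s !ltn_lexi // /tp /op /tq /oq.
  have := trP x; case: ifP => [/idxP|/negbT xC]; first by clear; lia.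
  case: ifP => [w|_]; last by move: (ends x xC); clear; lia.
  by have := zm x xC w; move: (ends x xC); clear; lia.
- move=> x y; rewrite /p /q /s => E.
  have : [\/ tp x = tp y /\ op x = op y, tq x = tq y /\ oq x = oq y |
             tr x = tr y /\ oo x = oo y].
    by case: E => [E|[E|E]]; [constructor 1|constructor 2|constructor 3];
       apply: eqlex E.
  clear E; have := sR x; have := sR y; have := rR x; have := rR y.
  rewrite /tp /op /tq /oq /tr /oo.
  have zx := zm x; have zy := zm y.
  case xC: (x \in C) zx; case yC: (y \in C) zy => zy zx.
  + by move=> _ _ _ _ E; apply: inj => //; case: E => -[]; clear; lia.
  + by case: (wrap y) => h1 h2 h3 h4 [] [_ E]; exfalso; move: h1 h2 h3 h4 E; clear; lia.
  + by case: (wrap x) => h1 h2 h3 h4 [] [_ E]; exfalso; move: h1 h2 h3 h4 E; clear; lia.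
  + have /andP[lx rx] := ends x (negbT xC); have /andP[ly ry] := ends y (negbT yC).
    case: (wrap x) zx => zx; case: (wrap y) zy => zy h1 h2 h3 h4 E.
    * by apply: sg_inj; case: E => -[]; move: h1 h2 h3 h4; clear; lia.
    * by have := zx isT isT; case: E => -[E1 E2] zz; exfalso;
         move: E1 E2 lx rx ly ry h1 h2 h3 h4 zz; clear; lia.
    * by have := zy isT isT; case: E => -[E1 E2] zz; exfalso;
         move: E1 E2 lx rx ly ry h1 h2 h3 h4 zz; clear; lia.
    * by apply: rk_inj; case: E => -[]; move: h1 h2 h3 h4; clear; lia.
- move=> x y; have [a1 a2 a3] := tP x; have [b1 b2 b3] := tP y.
  have c1 := trP y.
  split=> E.
  + have [] := eqlex _ _ _ _ (opQ x) (oqQ y) E.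
    have := sR y; move: a1 b2; rewrite /tp /tq /op /oq; have := idxP x; have := zm x.
    have := ends x; clear; case: (x \in C) => [_ _ /(_ isT)|]; first by lia.
    case: (wrap x) => [/(_ isT) _ /(_ isT isT) h _|/(_ isT) h _ _].
      by case: (y \in C); case: (wrap y); lia.
    by case: (y \in C); case: (wrap y); lia.
  + by have [] := eqlex _ _ _ _ (opQ x) (ooQ y) E; move: a1 c1; clear; lia.
  + by have [] := eqlex _ _ _ _ (oqQ x) (ooQ y) E; move: a3 c1; clear; lia.
move=> w [uw hw]; exists w; split=> // x y xy; rewrite (hw x y xy).
pose alt x y := (p x < p y < q x /\ q x < q y < s x /\ s x < s y) \/
                (p y < p x < q y /\ q y < q x < s y /\ s y < s x).
suff G a b : a != b -> (a \in C -> b \in C) -> (b \notin C -> wrap a -> wrap b) ->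
    e a b <-> alt a b.
  have G' : (y \in C -> x \in C) -> (x \notin C -> wrap y -> wrap x) -> e x y <-> alt x y.
    move=> h1 h2; rewrite Hsym; have := G y x; rewrite eq_sym xy => /(_ isT h1 h2) ->.
    by rewrite /alt; split; tauto.
  case xC: (x \in C) (G x y xy) G'; case yC: (y \in C); case: (wrap x);
    case: (wrap y) => G1 G2; by [apply: G1 | apply: G2].
move=> ab; rewrite /alt /p /q /s !ltn_lexi // /tp /op /tq /oq /tr /oo.
have ra := rR a; have rb := rR b; have sa := sR a; have sb := sR b.
case aC: (a \in C); [move=> /(_ isT) bC _ | move=> _].
  rewrite bC Hclq //; split=> // _.
  have ne : idx a <> idx b by move=> E; move/eqP: ab; apply; apply: inj.
  by move: (idxP a aC) (idxP b bC) ne; clear; lia.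
have {}aC := negbT aC; have /andP[la lb] := ends a aC.
case bC: (b \in C); [move=> _ | move=> /=].
  have := idxP b bC; case wa: (wrap a).
    have [w1 w2] := wrapP a aC wa; rewrite nb1 //; have := zP a aC wa.
    by move: w1 w2 la lb ra sa; clear; lia.
  by rewrite nb0 //; move: la lb ra sa; clear; lia.
have {}bC := negbT bC; move/(_ isT) => wab; have /andP[lb1 lb2] := ends b bC.
rewrite (negbTE (Hind aC bC)); split=> // E; exfalso; move: E.
case wb: (wrap b) wab => wab.
  have zb := zP b bC wb; have [w1 w2] := wrapP b bC wb.
  case wa: (wrap a).
    have za := zP a aC wa; have [w3 w4] := wrapP a aC wa.
    have := sg_mono a b; have := sg_mono b a.
    have : sg a <> sg b by move=> E; move/eqP: ab; apply; apply: sg_inj.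
    by move: w1 w2 w3 w4 la lb lb1 lb2 zb za ra rb sa sb; clear; lia.
  (* Either [b] occurs twice before [a], or [l a < l b]; then [inner] gives [r a <= r b], and [b]
     comes both first and last. *)
  have := inner a b aC bC wa wb; move: w1 w2 la lb lb1 lb2 zb ra rb sa sb; clear; lia.
case wa: (wrap a) wab; [by move/(_ isT) | move=> _].
have := rk_mono a b; have := rk_mono b a.
have : rk a <> rk b by move=> E; move/eqP: ab; apply; apply: rk_inj.
by move: la lb lb1 lb2 ra rb sa sb; clear; lia.
Qed.

End ThreeUniform.

(** * Two-uniform words from non-crossing chords *)

Section TwoUniform.
Variables (T : finType) (e : rel T) (C : {set T}) (idx : T -> nat)
  (wrap : T -> bool) (l r : T -> nat) (s : T -> bool).
Hypotheses (Hsym : symmetric e) (Hclq : {in C &, forall x y, x != y -> e x y})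
  (Hind : forall x y, x \notin C -> y \notin C -> ~~ e x y)
  (HM : split_model e C idx wrap l r).

(** The two ends of the chord in increasing order. [s a] moves the arc by half a turn, which
    exchanges [l a] and [r a] when it wraps. An empty arc gets a chord from 0 to [2 * #|C| + 1] that
    encloses everything. *)
Definition chord_start (a : T) : nat :=
  if wrap a then (if s a then l a else r a)
  else if l a == r a then 0 else l a + s a * #|C|.

Definition chord_end (a : T) : nat :=
  if wrap a then #|C| + (if s a then r a else l a)
  else if l a == r a then (#|C| + #|C|).+1 else r a + s a * #|C|.

Hypothesis Hcross : forall a b, a \notin C -> b \notin C ->
  ~ (chord_start a < chord_start b < chord_end a /\ chord_end a < chord_end b).

(** The clique vertex of index [i] is the chord from [i] to [m + i]; a chord of [a] crosses it
    exactly when the arc of [a] contains [i], whichever lift is used. *)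
Theorem two_representable : k_representable e 2.
Proof.
case: HM => idxP inj ends nb0 wrapP nb1 _ _.
set m := #|C| in idxP ends wrapP.
pose g := chord_start; pose h := chord_end.
have ghP a : a \notin C -> g a < h a <= (m + m).+1.
  move=> aC; have := ends a aC; have := wrapP a aC; rewrite /g /h /chord_start /chord_end.
  rewrite -/m; clear; case: (wrap a) => [/(_ isT)|_]; case: (s a);
    case: (l a =P r a); lia.
have [R1 [rk [rkR rk_inj rk_mono rk_eq]]] := rank_refining g.
have [R2 [sg [sgR sg_inj sg_mono sg_eq]]] := rank_refining (fun a => (m + m).+1 - h a).
pose R := R1 + R2; pose Q := (2 * R).+2.
have rR x : rk x < R by rewrite (leq_trans (rkR x)) ?leq_addr.
have sR x : sg x < R by rewrite (leq_trans (sgR x)) ?leq_addl.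
pose tp x := if x \in C then idx x else g x.
(* At a common place ends precede starts. Of equal starts the chord ending later opens first, and of
   equal ends the one starting earlier closes last, so ties create no crossing. *)
pose op x := if x \in C then 0 else (R + sg x).+1.
pose tq x := if x \in C then m + idx x else h x.
pose oq x := if x \in C then 0 else R - rk x.
have opQ x : op x < Q by rewrite /op /Q; have := sR x; clear; case: (x \in C); lia.
have oqQ x : oq x < Q by rewrite /oq /Q; have := rR x; clear; case: (x \in C); lia.
have eqlex t t' o o' : o < Q -> o' < Q -> t * Q + o = t' * Q + o' -> t = t' /\ o = o'.
  move=> k k' E; have := ltn_lexi t t' k k'; have := ltn_lexi t' t k' k.
  by rewrite E ltnn; clear; lia.
pose p x := tp x * Q + op x; pose q x := tq x * Q + oq x.
have [] := @two_uniform_keys T p q.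
- move=> x; rewrite /p /q ltn_lexi // /tp /op /tq /oq.
  case xC: (x \in C); first by move: (idxP x xC); clear; lia.
  by case/andP: (ghP x (negbT xC)) => ->.
- move=> x y E.
  have : op x = op y \/ oq x = oq y.
    by case: E => /eqlex []; auto.
  have Ei : tp x = tp y \/ tq x = tq y.
    by case: E => /eqlex []; auto.
  have := rR x; have := rR y; have := sR x; have := sR y; move: Ei; rewrite /tp /tq /op /oq.
  case xC: (x \in C); case yC: (y \in C).
  + by move=> E1 _ _ _ _ _; apply: inj => //; move: E1; clear; lia.
  + by move=> _ h1 h2 h3 h4 E1; exfalso; move: h1 h2 h3 h4 E1; clear; lia.
  + by move=> _ h1 h2 h3 h4 E1; exfalso; move: h1 h2 h3 h4 E1; clear; lia.
  + move=> _ h1 h2 h3 h4 []; first by move=> E1; apply: sg_inj; move: E1; clear; lia.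
    by move=> E1; apply: rk_inj; move: h1 h2 h3 h4 E1; clear; lia.
- move=> x y E; have [E1 E2] := eqlex _ _ _ _ (opQ x) (oqQ y) E.
  move: E1 E2; rewrite /tp /tq /op /oq; have := rR y.
  case xC: (x \in C); last by case: (y \in C); clear; lia.
  case yC: (y \in C); last by clear; lia.
  by move: (idxP x xC) (idxP y yC); clear; lia.
move=> w [uw hw]; exists w; split=> // x y xy; rewrite (hw x y xy).
pose alt x y := (p x < p y < q x /\ q x < q y) \/ (p y < p x < q y /\ q y < q x).
suff G a b : a != b -> (a \in C -> b \in C) -> e a b <-> alt a b.
  have G' : (y \in C -> x \in C) -> e x y <-> alt x y.
    move=> h1; rewrite Hsym; have := G y x; rewrite eq_sym xy => /(_ isT h1) ->.
    by rewrite /alt; split; tauto.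
  by case xC: (x \in C) (G x y xy) G'; case yC: (y \in C) => G1 G2; by [apply: G1 | apply: G2].
move=> ab; rewrite /alt /p /q !ltn_lexi // /tp /op /tq /oq.
have ra := rR a; have rb := rR b; have sa := sR a; have sb := sR b.
case aC: (a \in C); [move=> /(_ isT) bC | move=> _].
  rewrite bC Hclq //; split=> // _.
  have ne : idx a <> idx b by move=> E; move/eqP: ab; apply; apply: inj.
  by move: (idxP a aC) (idxP b bC) ne; clear; lia.
have {}aC := negbT aC; have gha := ghP a aC.
case bC: (b \in C).
  have := idxP b bC; have := ends a aC; case wa: (wrap a).
    have [w1 w2] := wrapP a aC wa; rewrite nb1 // /g /h /chord_start /chord_end wa -/m.
    by move: w1 w2 ra sa; clear; case: (s a); lia.
  rewrite nb0 // /g /h /chord_start /chord_end wa -/m.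
  by move: ra sa; clear; case: (s a); case: (l a =P r a); lia.
have {}bC := negbT bC; have ghb := ghP b bC.
rewrite (negbTE (Hind aC bC)); split=> // E; exfalso; move: E.
have := Hcross aC bC; have := Hcross bC aC; rewrite -/(g a) -/(g b) -/(h a) -/(h b).
have := rk_mono a b; have := rk_mono b a; have := sg_mono a b; have := sg_mono b a.
have := rk_eq a b; have := rk_eq b a; have := sg_eq a b; have := sg_eq b a.
by move: gha ghb ra rb sa sb; clear; lia.
Qed.

End TwoUniform.

(** * Unbalanced cycles of overlapping arcs *)

(** Only the adjacencies of the clique vertices must be realised: the separation hypothesis makes
    vertices with the prescribed adjacencies distinct. *)
Lemma contains_split (T : finType) (e : rel T) (C : {set T}) k (nbs : seq (seq nat)) (a : nat ->
    T) :
  symmetric e -> irreflexive e -> {in C &, forall x y, x != y -> e x y} ->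
  (forall x y, x \notin C -> y \notin C -> ~~ e x y) ->
  (forall j, j < size nbs -> a j \notin C) ->
  (forall i j, i < j -> j < size nbs -> a i != a j) ->
  (forall i i', i < i' < k -> exists2 j, j < size nbs &
     (i \in nth [::] nbs j) != (i' \in nth [::] nbs j)) ->
  (forall i, i < k -> exists2 c, c \in C & forall j, j < size nbs ->
     e c (a j) = (i \in nth [::] nbs j)) ->
  contains_induced e (split_rel k nbs).
Proof.
move=> Hsym Hirr Hclq Hind aC ainj sep ex.
pose good (i : nat) c := (c \in C) && [forall j : 'I_(size nbs), e c (a j) == (i \in nth [::] nbs
    j)].
pose c (i : nat) := odflt (a 0) [pick c | good i c].
have cP i : i < k -> c i \in C /\ forall j, j < size nbs -> e (c i) (a j) = (i \in nth [::] nbs j).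
  move=> ik; rewrite /c; case: pickP => [x /andP[xC /forallP h]|none] /=.
    by split=> // j jn; apply/eqP; apply: (h (Ordinal jn)).
  have [x xC h] := ex i ik; have /andP[] := none x; split=> //.
  by apply/forallP => j; rewrite h.
pose f (i : 'I_(k + size nbs)) := if i < k then c i else a (i - k).
have cinj i i' : i < i' < k -> c i != c i'.
  move=> h; have [j jn] := sep _ _ h; case/andP: h => ii' i'k.
  have [_ e1] := cP i (ltn_trans ii' i'k); have [_ e2] := cP i' i'k.
  by rewrite -e1 // -e2 //; apply: contraNneq => ->.
have fne (i i' : 'I_(k + size nbs)) : i < i' -> f i != f i'.
  rewrite /f => ii'; have := ltn_ord i'; case: (ltnP i' k) => i'k; case: (ltnP i k) => ik b.
  - by rewrite cinj // ii'.
  - by have := leq_ltn_trans ik (ltn_trans ii' i'k); rewrite ltnn.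
  - have [ciC _] := cP i ik; apply: contraTneq ciC => ->; apply: aC; lia.
  - by apply: ainj; lia.
exists f; split=> [i i' E|i i'].
  case: (ltngtP i i') => [/fne|/fne|/val_inj //]; by rewrite E eqxx.
rewrite /split_rel; case: eqP => [->|ne] /=; first by rewrite Hirr.
have ff : f i != f i'.
  case: (ltngtP i i') => [/fne //|/fne|/val_inj //]; by rewrite eq_sym.
move: ff; rewrite /split_adj /f; have := ltn_ord i'; have := ltn_ord i.
case: (ltnP i k) => ik; case: (ltnP i' k) => i'k b1 b2 ff.
- by apply: Hclq => //; [case: (cP i ik) | case: (cP i' i'k)].
- by have [_ ->] := cP i ik => //; lia.
- by rewrite Hsym; have [_ ->] := cP i' i'k => //; lia.
by apply/negbTE; apply: Hind; apply: aC; lia.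
Qed.

Section Cycle.
Local Open Scope Z_scope.
Variables (T : finType) (C : {set T}) (m : Z) (u v : T -> Z).

(** Lift number [q] of the arc of [a] is the interval [(lo a q, hi a q]] of the line. *)
Definition lo a q := u a + q * m.
Definition hi a q := v a + q * m.
Definition overlap a p b q :=
  (lo a p < lo b q /\ lo b q < hi a p /\ hi a p < hi b q) \/
  (lo b q < lo a p /\ lo a p < hi b q /\ hi b q < hi a p).
Definition nested a p b q := lo b q <= lo a p /\ hi a p <= hi b q.

Hypothesis len : forall a, a \notin C -> u a <= v a <= u a + m.
Hypothesis nodouble : forall a b p q q', a \notin C -> b \notin C ->
  overlap a p b q -> overlap a p b q' -> q = q'.

(** A chordless cycle of [n] arcs, unrolled into a periodic sequence to avoid indices modulo [n]:
    [tau i] is the lift reached at step [i], and the cycle closes up after [t] turns. *)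
Record cyc (n : nat) (A : nat -> T) (tau : nat -> Z) (t : Z) : Prop := Cyc {
  cyC : forall i, A i \notin C;
  cyA : forall i, A (i + n)%N = A i;
  cyt : forall i, tau (i + n)%N = tau i + t;
  cystep : forall i, overlap (A i) (tau i) (A i.+1) (tau i.+1);
  cydist : forall i j, (i < j)%N -> (j < i + n)%N -> A i != A j;
  cynon : forall i j p q, (i.+1 < j)%N -> (j.+1 < i + n)%N -> ~ overlap (A i) p (A j) q }.

Lemma cyc_shift n A tau t k : cyc n A tau t ->
  cyc n (fun i => A (i + k)%N) (fun i => tau (i + k)%N) t.
Proof.
case=> c1 c2 c3 c4 c5 c6; split=> //.
- by move=> i; rewrite addnAC.
- by move=> i; rewrite addnAC.
- by move=> i j h1 h2; apply: c5; lia.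
- by move=> i j p q h1 h2; apply: c6; lia.
Qed.

Lemma shift_disjoint a q q' x : a \notin C ->
  lo a q < x <= hi a q -> lo a q' < x <= hi a q' -> q = q'.
Proof.
move=> /len; rewrite /lo /hi => h h1 h2.
have [|[|]] : q < q' \/ q = q' \/ q' < q by lia.
- by move=> lt; have : q * m + m <= q' * m; [nia | lia].
- by [].
- by move=> lt; have : q' * m + m <= q * m; [nia | lia].
Qed.

(** [Y] meets [Z] without overlapping it, so they are nested; [Z] inside [Y] would put [X] inside
    [Y]. *)
Lemma nested_trap X p Y q Z r : nested X p Z r -> overlap X p Y q -> ~ overlap Y q Z r -> nested
    Y q Z r.
Proof. rewrite /nested /overlap; lia. Qed.

Lemma overlap_sym X p Y q : overlap X p Y q -> overlap Y q X p.
Proof. rewrite /overlap; lia. Qed.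

Lemma overlap_shift X p Y q r : overlap X p Y q -> overlap X (p + r) Y (q + r).
Proof. rewrite /overlap /lo /hi; lia. Qed.

Lemma nested_shift X p Y q r : nested X p Y q -> nested X (p + r) Y (q + r).
Proof. rewrite /nested /lo /hi; lia. Qed.

Section Fixed.
Variables (n : nat) (A : nat -> T) (tau : nat -> Z) (t : Z).
Hypothesis H : cyc n A tau t.

Lemma nested_overlap_lift i j q r : nested (A i) (tau i) (A j) q -> overlap (A i) (tau i) (A j) r
    -> q = r.
Proof.
have jC := cyC H j => S O; apply: (@shift_disjoint _ _ _ (Z.max (lo (A i) (tau i)) (lo (A j) r) +
    1) jC);
  move: S O; rewrite /nested /overlap; lia.
Qed.

Lemma trap_up i k j q : nested (A i) (tau i) (A j) q -> (i <= k)%N -> (k.+1 < j)%N ->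
  (j < i + n)%N -> nested (A k) (tau k) (A j) q.
Proof.
move=> S; elim: k => [|k IH] ik kj jn.
  by have -> : 0%N = i by lia.
have [E|lt] : k.+1 = i \/ (i <= k)%N by lia.
  by rewrite E.
apply: nested_trap (IH lt _ jn) (cystep H k) _; first by lia.
by apply: (cynon H); lia.
Qed.

Lemma trap_down i d j q : nested (A (i + d)) (tau (i + d)) (A j) q -> (j.+1 < i)%N ->
  (i + d < j + n)%N -> nested (A i) (tau i) (A j) q.
Proof.
elim: d => [|d IH] S ji dn; first by rewrite addn0 in S.
apply: IH => //; last by lia.
apply: nested_trap S _ _; first by apply: overlap_sym; rewrite addnS; apply: (cystep H).
by move=> /overlap_sym; apply: (cynon H); lia.
Qed.

(** Nesting travels along the cycle until two steps before [A j]. The arc one step before [A j] then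
    overlaps the lift [q], and [nodouble] applies, or lies in it, and the lifts [q] and [tau j]
    share a point. *)
Lemma nested_lift_fwd i j q : (i < j)%N -> (j < i + n)%N ->
  nested (A i) (tau i) (A j) q -> q = tau j.
Proof.
case: j => // j ij jn S; have O := cystep H j.
have [E|lt] : i = j \/ (i < j)%N by lia.
  by rewrite -E in S O *; apply: nested_overlap_lift S O.
case: j lt {ij} jn S O => // j ij jn S O.
have S1 : nested (A j) (tau j) (A j.+2) q by apply: trap_up S _ _ _; lia.
have S2 := nested_trap S1 (cystep H j).
have [O'|nO] : overlap (A j.+1) (tau j.+1) (A j.+2) q \/ ~ overlap (A j.+1) (tau j.+1) (A j.+2) q.
  by rewrite /overlap; lia.
  exact: nodouble (cyC H _) (cyC H _) O' O.
exact: nested_overlap_lift (S2 nO) O.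
Qed.

Lemma nested_lift_bwd i j q : (j < i)%N -> (i < j + n)%N ->
  nested (A i) (tau i) (A j) q -> q = tau j.
Proof.
move=> ji ijn S; have O := overlap_sym (cystep H j).
have [E|lt] : i = j.+1 \/ (j.+1 < i)%N by lia.
  by rewrite -E in S O *; apply: nested_overlap_lift S O.
have S1 : nested (A j.+2) (tau j.+2) (A j) q.
  apply: (@trap_down _ (i - j.+2)); last by lia.
    by have -> : (j.+2 + (i - j.+2) = i)%N by lia.
  by lia.
have S2 := nested_trap S1 (overlap_sym (cystep H j.+1)).
have [O'|nO] : overlap (A j.+1) (tau j.+1) (A j) q \/ ~ overlap (A j.+1) (tau j.+1) (A j) q.
  by rewrite /overlap; lia.
  exact: nodouble (cyC H _) (cyC H _) O' O.
exact: nested_overlap_lift (S2 nO) O.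
Qed.

(** The inner arc reaches the outer one along both directions of the cycle. The two ways predict
    lifts that differ by [t]. *)
Lemma nested_lift i j p q : (i < j)%N -> (j < i + n)%N ->
  nested (A i) p (A j) q \/ nested (A j) q (A i) p -> t = 0 /\ q - p = tau j - tau i.
Proof.
move=> ij ji [] S.
  have S1 := nested_shift (tau i - p) S.
  rewrite (_ : p + (tau i - p) = tau i) in S1; last by lia.
  have E1 := nested_lift_fwd ij ji S1.
  have S2 := nested_shift t S1; rewrite -(cyt H) -{1}(cyA H) in S2.
  have E2 := nested_lift_bwd (i := (i + n)%N) ji _ S2.
  suff : q + (tau i - p) + t = tau j by lia.
  by apply: E2; lia.
have S1 := nested_shift (tau j - q) S.
rewrite (_ : q + (tau j - q) = tau j) in S1; last by lia.
have E1 := nested_lift_bwd ij ji S1.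
have S2 := S1; rewrite -(cyA H i) in S2.
have E2 := nested_lift_fwd (j := (i + n)%N) ji _ S2.
have := cyt H i; suff : p + (tau j - q) = tau (i + n)%N by lia.
by apply: E2; lia.
Qed.

(** Lifts with a common point overlap or are nested. The chordless cycle allows the first only for
    consecutive arcs in its own lifts, and [nested_lift] the second only for [t = 0]. *)
Lemma common_point i j p q x : (i < j)%N -> (j < i + n)%N ->
  lo (A i) p < x <= hi (A i) p -> lo (A j) q < x <= hi (A j) q ->
  [\/ j = i.+1 /\ q - p = tau j - tau i, j.+1 = (i + n)%N /\ q - p = tau j - tau i - t |
   t = 0 /\ q - p = tau j - tau i /\ (nested (A i) p (A j) q \/ nested (A j) q (A i) p)].
Proof.
move=> ij ji h1 h2.
have [O|S] : overlap (A i) p (A j) q \/ (nested (A i) p (A j) q \/ nested (A j) q (A i) p).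
  by move: h1 h2; rewrite /overlap /nested; lia.
  have := overlap_shift (tau i - p) O.
  rewrite (_ : p + (tau i - p) = tau i); last by lia.
  move=> O1.
  have [E|ne] := eqVneq j i.+1.
    constructor 1; split=> //; rewrite E in O1 *.
    have := nodouble (cyC H _) (cyC H _) O1 (cystep H i); lia.
  have [E|ne'] := eqVneq j.+1 (i + n)%N.
    constructor 2; split=> //.
    have O2 := cystep H j; rewrite E (cyt H) (cyA H) in O2.
    have := overlap_shift (- t) (overlap_sym O2).
    rewrite (_ : tau i + t + - t = tau i); last by lia.
    by move=> O3; have := nodouble (cyC H _) (cyC H _) O1 O3; lia.
  by case: (@cynon _ _ _ _ H i j p q) => //; lia.
by constructor 3; have [] := nested_lift ij ji S.
Qed.

Lemma nonempty i : lo (A i) (tau i) < hi (A i) (tau i).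
Proof. have := cystep H i; rewrite /overlap; lia. Qed.

(* When the cycle winds around at least twice, the lift of A 0 one turn away
   separates the ends of the chain, yet no link of the chain can meet it. *)
Lemma winding_small : (2 < n)%N -> -1 <= t <= 1.
Proof.
move=> n3; have iC := cyC H 0%N; have := len iC => lenA.
have ne0 := nonempty 0.
(* By [common_point], a meeting would give [s = 0], [s = t] or [t = 0]. *)
have disj k s x : (k <= n)%N -> s <> 0 -> s <> t -> t <> 0 ->
    lo (A 0%N) (tau 0%N + s) < x <= hi (A 0%N) (tau 0%N + s) ->
    lo (A k) (tau k) < x <= hi (A k) (tau k) -> False.
  move=> kn s0 st t0 h1 h2.
  have [E|] := eqVneq k 0%N.
    by rewrite E in h2; have := shift_disjoint iC h1 h2; lia.
  have [E|nn k0] := eqVneq k n.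
    have E' : A k = A 0%N by rewrite E -(cyA H 0%N).
    have E2 : tau k = tau 0%N + t by rewrite E -(cyt H).
    by rewrite E' E2 in h2; have := shift_disjoint iC h1 h2; lia.
  case: (common_point (i := 0) (j := k) _ _ h1 h2); lia.
have perm : m > 0 by move: lenA ne0; rewrite /lo /hi; lia.
have [t1|[t1|//]] : t > 1 \/ t < -1 \/ -1 <= t <= 1 by lia.
- have left k : (k <= n)%N -> hi (A k) (tau k) <= lo (A 0%N) (tau 0%N + 1).
    elim: k => [|k IH] kn; first by move: lenA; rewrite /lo /hi; lia.
    have {}IH := IH (ltnW kn); have O := cystep H k.
    have D := @disj k.+1 1 (lo (A 0%N) (tau 0%N + 1) + 1) kn.
    have [//|lt] : hi (A k.+1) (tau k.+1) <= lo (A 0%N) (tau 0%N + 1) \/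
      lo (A 0%N) (tau 0%N + 1) < hi (A k.+1) (tau k.+1) by lia.
    case: D; [lia | lia | lia | |].
      by move: ne0; rewrite /lo /hi; lia.
    by move: O IH lt; rewrite /overlap; lia.
  have := left n (leqnn n); have := cyA H 0%N; have := cyt H 0%N; rewrite add0n => -> ->.
  move: ne0; rewrite /lo /hi; nia.
- have right k : (k <= n)%N -> hi (A 0%N) (tau 0%N - 1) <= lo (A k) (tau k).
    elim: k => [|k IH] kn; first by move: lenA; rewrite /lo /hi; lia.
    have {}IH := IH (ltnW kn); have O := cystep H k.
    have D := @disj k.+1 (- 1) (hi (A 0%N) (tau 0%N - 1)) kn.
    have [//|lt] : hi (A 0%N) (tau 0%N - 1) <= lo (A k.+1) (tau k.+1) \/
      lo (A k.+1) (tau k.+1) < hi (A 0%N) (tau 0%N - 1) by lia.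
    case: D; [lia | lia | lia | |].
      by move: ne0; rewrite /lo /hi; lia.
    by move: O IH lt; rewrite /overlap; lia.
  have := right n (leqnn n); have := cyA H 0%N; have := cyt H 0%N; rewrite add0n => -> ->.
  move: ne0; rewrite /lo /hi; nia.
Qed.

(** * Induced subgraphs read off a cycle *)

Variables (e : rel T) (idx : T -> Z).
Hypotheses (Hsym : symmetric e) (Hirr : irreflexive e)
  (Hclq : {in C &, forall x y, x != y -> e x y})
  (Hind : forall x y, x \notin C -> y \notin C -> ~~ e x y)
  (Hnb : forall a c, a \notin C -> c \in C ->
     (e c a <-> exists q, lo a q < idx c <= hi a q))
  (Hsurj : forall x, 0 < m -> exists2 c, c \in C & exists q, x = idx c + q * m).

Lemma vertex_at x i p : lo (A i) p < x <= hi (A i) p ->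
  exists2 c, c \in C & forall a, a \notin C -> (e c a <-> exists q, lo a q < x <= hi a q).
Proof.
move=> h; have m0 : 0 < m by have := len (cyC H i); move: h; rewrite /lo /hi; lia.
have [c cC [q ->]] := Hsurj x m0; exists c => // a aC; rewrite Hnb //.
by split=> -[r hr]; [exists (r + q) | exists (r - q)]; move: hr; rewrite /lo /hi; lia.
Qed.

(** As [t] is not zero, non-consecutive arcs share no point. Clique vertex [i] is taken in the
    common part of [A i] and its predecessor. *)
Lemma contains_sun : (2 < n)%N -> ~~ odd n -> t <> 0 -> contains_induced e (even_sun n).
Proof.
move=> n3 nodd t0; have n4 : (3 < n)%N by lia.
have nthE j : (j < n)%N -> nth [::] (sun_nbs n) j = [:: j; (j.+1 %% n)%N].
  by move=> jn; rewrite (nth_map 0%N) ?size_iota // nth_iota.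
apply: (contains_split Hsym Hirr Hclq Hind (a := A)); rewrite /sun_nbs size_map size_iota.
- by move=> j _; apply: (cyC H).
- by move=> i j ij jn; apply: (cydist H); lia.
- move=> i i' /andP[ii' i'n].
  (* Pair number [i'] separates [i] from [i'], except that the last pair contains both 0 and
     [n - 1]. *)
  have [/andP[/eqP i0 /eqP E]|ne] := boolP ((i == 0%N) && (i'.+1 == n)).
    exists 0%N; first by lia.
    by rewrite nthE ?modn_small ?inE; lia.
  exists i' => //; rewrite nthE // !inE eqxx /=.
  have [E|lt] : i'.+1 = n \/ (i'.+1 < n)%N by lia.
    by rewrite E modnn; lia.
  by rewrite modn_small; lia.
(* The index [i + n.-1] stands for the predecessor of [i], also when [i = 0]. *)
move=> i iltn; have := cystep H (i + n.-1); set k := (i + n.-1)%N => O.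
have kE : k.+1 = (i + n)%N by rewrite /k; lia.
pose x := Z.max (lo (A k) (tau k)) (lo (A k.+1) (tau k.+1)) + 1.
have xk : lo (A k) (tau k) < x <= hi (A k) (tau k) by move: O; rewrite /overlap /x; lia.
have xk1 : lo (A k.+1) (tau k.+1) < x <= hi (A k.+1) (tau k.+1).
  by move: O; rewrite /overlap /x; lia.
have [c cC hc] := vertex_at xk; exists c => // j jn; rewrite nthE //.
apply/idP/idP; last first.
  rewrite !inE => /orP[/eqP E|/eqP E]; apply/hc; try exact: (cyC H).
    by exists (tau k.+1); rewrite -E -(cyA H i) -kE.
  exists (tau k); suff -> : A j = A k by [].
  have [E'|lt] : j.+1 = n \/ (j.+1 < n)%N by lia.
    by rewrite /k E E' modnn; have -> : n.-1 = j by lia.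
  by rewrite /k E modn_small // -(cyA H j); congr A; lia.
case/(hc _ (cyC H j)) => q hq; rewrite !inE; apply/negPn/negP => ne.
have {}ne : j <> i /\ j.+1 <> i /\ ~ (j.+1 = n /\ i = 0%N).
  move: ne; have [E|lt] : j.+1 = n \/ (j.+1 < n)%N by lia.
    by rewrite E modnn; lia.
  by rewrite modn_small //; lia.
(* A representative of [j] within one period after both [k] and [k.+1]. *)
have [j' E [j'1 j'2]] : exists2 j', A j' = A j & (k.+2 <= j')%N /\ (j' < k + n)%N.
  have [lt|lt] : (i < j)%N \/ (j < i)%N by lia.
    by exists (j + n)%N; [rewrite (cyA H) | lia].
  by exists (j + n + n)%N; [rewrite !(cyA H) | lia].
rewrite -E in hq.
by case: (common_point (i := k) _ _ xk hq); try lia;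
   case: (common_point (i := k.+1) _ _ xk1 hq); lia.
Qed.

Hypothesis t0 : t = 0.

Definition covers i x := (lo (A i) (tau i) <? x) && (x <=? hi (A i) (tau i)).

(** Since [t = 0] the cycle closes on the line. By [common_point] only the lift [tau j] of [A j] can
    share a point with the lift [tau i] of [A i], so these lifts alone decide adjacency. *)
Lemma line_vertex i x : (i < n)%N -> covers i x ->
  exists2 c, c \in C & forall j, (j < n)%N -> e c (A j) = covers j x.
Proof.
move=> iltn mi; have hi' : lo (A i) (tau i) < x <= hi (A i) (tau i).
  by move: mi; rewrite /covers; lia.
have [c cC hc] := vertex_at hi'; exists c => // j jn.
apply/idP/idP => [|hj]; last first.
  by apply/hc; [exact: (cyC H) | exists (tau j); move: hj; rewrite /covers; lia].
case/(hc _ (cyC H j)) => q hq; suff E : q = tau j by move: hq; rewrite E /covers; lia.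
case: (ltngtP i j) => ij.
- by case: (common_point (i := i) (j := j) _ _ hi' hq); lia.
- by case: (common_point (i := j) (j := i) _ _ hq hi'); lia.
by rewrite -ij in hq *; apply: shift_disjoint (cyC H i) hq hi'.
Qed.

Definition nestedb i j := (lo (A j) (tau j) <=? lo (A i) (tau i)) &&
                      (hi (A i) (tau i) <=? hi (A j) (tau j)).

Lemma nestedb_covers i j x : nestedb i j -> covers i x -> covers j x.
Proof. rewrite /nestedb /covers; lia. Qed.

Lemma covers_step i : exists x, covers i x && covers i.+1 x.
Proof.
exists (Z.max (lo (A i) (tau i)) (lo (A i.+1) (tau i.+1)) + 1).
by have := cystep H i; rewrite /overlap /covers; lia.
Qed.

Lemma covers_diff i j : overlap (A i) (tau i) (A j) (tau j) -> exists x, covers i x && ~~ covers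
    j x.
Proof.
rewrite /overlap => -[h|h]; first by exists (lo (A i) (tau i) + 1); rewrite /covers; lia.
by exists (hi (A i) (tau i)); rewrite /covers; lia.
Qed.

Lemma overlap_last : (0 < n)%N -> overlap (A 0%N) (tau 0%N) (A n.-1) (tau n.-1).
Proof.
move=> n0; apply: overlap_sym; have := cystep H n.-1; rewrite prednK //.
have E1 : A n = A 0%N := cyA H 0%N; have E2 : tau n = tau 0%N + t := cyt H 0%N.
by rewrite E1 E2 t0 Z.add_0_r.
Qed.

(** [A 0] is [b] and [A i] is [a_i]. Clique vertex [i], counted from 0, is taken in [A i] and
    [A i.+1], except that the first is in [A 1] outside [A 0] and the last in [A n.-1] outside
    [A 0]. *)
Lemma contains_F2 : (4 < n)%N -> (forall i, (1 < i)%N -> (i.+1 < n)%N -> nestedb i 0) ->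
  (forall i j x, (0 < i)%N -> (i.+1 < j)%N -> (j < n)%N -> covers i x -> covers j x -> False) ->
  contains_induced e (F2 n).
Proof.
move=> n5 big0 disj.
have nth0 : nth [::] (F2_nbs n) 0 = iota 1 (n - 2) by [].
have nthS j : (j.+1 < n)%N -> nth [::] (F2_nbs n) j.+1 = [:: j; j.+1].
  by move=> jn; rewrite /= (nth_map 0%N) ?size_iota ?nth_iota //; lia.
have sz : size (F2_nbs n) = n by rewrite /= size_map size_iota; lia.
apply: (contains_split Hsym Hirr Hclq Hind (a := A)); rewrite sz.
- by move=> j _; apply: (cyC H).
- by move=> i j ij jn; apply: (cydist H); lia.
- move=> i i' /andP[ii' i'n]; have [E|lt] : i'.+1 = n \/ (i'.+1 < n)%N by lia.
    have [->|i0] := eqVneq i 0%N.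
      by exists 1%N; rewrite ?nthS // ?inE; lia.
    by exists 0%N; rewrite ?nth0 ?mem_iota; lia.
  by exists i'.+1 => //; rewrite nthS // !inE; lia.
move=> i iltn.
suff [x [i0 i0n hx] mx] : exists2 x, exists2 i0, (i0 < n)%N & covers i0 x &
     forall j, (j < n)%N -> covers j x = (i \in nth [::] (F2_nbs n) j).
  by have [c cC hc] := line_vertex i0n hx; exists c => // j jn; rewrite hc // mx.
have [E|i0] := eqVneq i 0%N.
  have [x /andP[x1 x0]] := covers_diff (overlap_sym (cystep H 0)).
  exists x; first by exists 1%N => //; lia.
  case=> [|[|j]] jn; [rewrite nth0 mem_iota (negbTE x0); lia |
                      by rewrite nthS // x1 E inE |].
  rewrite nthS // E inE /=; apply/negbTE/negP => mj.
  have [E2|lt] : j.+3 = n \/ (j.+3 < n)%N by lia.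
    by apply: (disj 1%N j.+2 x) => //; lia.
  by move/negP: x0; apply; apply: nestedb_covers mj; apply: big0.
have [E|lt] : i.+1 = n \/ (i.+1 < n)%N by lia.
  have [x /andP[x1 x0]] := covers_diff (overlap_sym (overlap_last (ltn_trans (isT : (0 < 4)%N)
      n5))).
  have E1 : n.-1 = i by lia.
  rewrite E1 in x1; exists x; first by exists i.
  case=> [|j] jn; [rewrite nth0 mem_iota (negbTE x0); lia | rewrite nthS // !inE].
  have [Ej|ne] := eqVneq i j.+1; first by rewrite -Ej x1 orbT.
  have -> : (i == j) = false by lia.
  apply/negbTE/negP => mj; have [j0|j0] : j = 0%N \/ (0 < j)%N by lia.
    by apply: (disj j.+1 i x) => //; lia.
  by move/negP: x0; apply; apply: nestedb_covers mj; apply: big0 => //; lia.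
have [x /andP[x1 x2]] := covers_step i.
exists x; first by exists i.
case=> [|j] jn.
  rewrite nth0 mem_iota; have -> : (0 < i < 1 + (n - 2))%N by lia.
  have [h|h] : (1 < i)%N \/ (1 < i.+1)%N /\ (i.+2 < n)%N by lia.
    by apply: nestedb_covers x1; apply: big0.
  by apply: nestedb_covers x2; case: h; apply: big0.
rewrite nthS // !inE; have [Ej|ne1] := eqVneq i j; first by rewrite -Ej x2.
have [Ej|ne2] := eqVneq i j.+1; first by rewrite -Ej x1.
apply/negbTE/negP => mj; have [h|h] : (j.+1 < i)%N \/ (i < j)%N by lia.
  by apply: (disj j.+1 i.+1 x) => //; lia.
by apply: (disj i j.+1 x) => //; lia.
Qed.

(** [A 0] and [A 1] are [b1] and [b2], and [A i.+1] is [a_i]. Clique vertex [i], counted from 0, is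
    taken in [A i.+1] and [A i.+2], except that the first is in [A 2] outside [A 1] and the last in
    [A n.-1] outside [A 0]. *)
Lemma contains_F1 : (4 < n)%N -> (forall i, (1 < i)%N -> (i.+1 < n)%N -> nestedb i 0) ->
  (forall i, (2 < i)%N -> (i < n)%N -> nestedb i 1) ->
  (forall i j x, (1 < i)%N -> (i.+1 < j)%N -> (j < n)%N -> covers i x -> covers j x -> False) ->
  contains_induced e (F1 n).
Proof.
move=> n5 big0 big1 disj.
have nth0 : nth [::] (F1_nbs n) 0 = iota 0 (n - 2) by [].
have nth1 : nth [::] (F1_nbs n) 1 = iota 1 (n - 2) by [].
have nthS j : (j.+2 < n)%N -> nth [::] (F1_nbs n) j.+2 = [:: j; j.+1].
  by move=> jn; rewrite /= (nth_map 0%N) ?size_iota ?nth_iota //; lia.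
have sz : size (F1_nbs n) = n by rewrite /= size_map size_iota; lia.
apply: (contains_split Hsym Hirr Hclq Hind (a := A)); rewrite sz.
- by move=> j _; apply: (cyC H).
- by move=> i j ij jn; apply: (cydist H); lia.
- move=> i i' /andP[ii' i'n]; have [E|lt] : i'.+2 = n \/ (i'.+2 < n)%N by lia.
    by exists 0%N; rewrite ?nth0 ?mem_iota; lia.
  by exists i'.+2 => //; rewrite nthS // !inE; lia.
move=> i iltn.
suff [x [i0 i0n hx] mx] : exists2 x, exists2 i0, (i0 < n)%N & covers i0 x &
     forall j, (j < n)%N -> covers j x = (i \in nth [::] (F1_nbs n) j).
  by have [c cC hc] := line_vertex i0n hx; exists c => // j jn; rewrite hc // mx.
have [E|i0] := eqVneq i 0%N.
  have [x /andP[x2 x1]] := covers_diff (overlap_sym (cystep H 1)).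
  exists x; first by exists 2%N => //; lia.
  case=> [|[|[|j]]] jn.
  - rewrite nth0 mem_iota (nestedb_covers (big0 2%N _ _) x2); lia.
  - rewrite nth1 mem_iota (negbTE x1); lia.
  - by rewrite nthS // x2 E inE.
  rewrite nthS // E inE /=; apply/negbTE/negP => mj.
  by move/negP: x1; apply; apply: nestedb_covers mj; apply: big1.
have [E|lt] : i.+2 = n \/ (i.+2 < n)%N by lia.
  have [x /andP[x1 x0]] := covers_diff (overlap_sym (overlap_last (ltn_trans (isT : (0 < 4)%N)
      n5))).
  have E1 : n.-1 = i.+1 by lia.
  rewrite E1 in x1; exists x; first by exists i.+1; lia.
  case=> [|[|j]] jn.
  - rewrite nth0 mem_iota (negbTE x0); lia.
  - rewrite nth1 mem_iota (nestedb_covers (big1 i.+1 _ _) x1); lia.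
  rewrite nthS // !inE; have [Ej|ne] := eqVneq i j.+1; first by rewrite -Ej x1 orbT.
  have -> : (i == j) = false by lia.
  apply/negbTE/negP => mj.
  by move/negP: x0; apply; apply: nestedb_covers mj; apply: big0 => //; lia.
have [x /andP[x1 x2]] := covers_step i.+1.
exists x; first by exists i.+1; lia.
case=> [|[|j]] jn.
- rewrite nth0 mem_iota (nestedb_covers (big0 i.+1 _ _) x1); lia.
- rewrite nth1 mem_iota (nestedb_covers (big1 i.+2 _ _) x2); lia.
rewrite nthS // !inE; have [Ej|ne1] := eqVneq i j; first by rewrite -Ej x2.
have [Ej|ne2] := eqVneq i j.+1; first by rewrite -Ej x1.
apply/negbTE/negP => mj; have [h|h] : (j.+1 < i)%N \/ (i < j)%N by lia.
  by apply: (disj j.+2 i.+2 x) => //; lia.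
by apply: (disj i.+1 j.+2 x) => //; lia.
Qed.

(** The six ends cut out five parts, which from left to right hold the clique vertices 2, 3, 0, 4,
    1. *)
Lemma contains_F0_of i j k : (i < n)%N -> (j < n)%N -> (k < n)%N ->
  A i != A j -> A i != A k -> A j != A k ->
  lo (A i) (tau i) < lo (A j) (tau j) -> lo (A j) (tau j) < lo (A k) (tau k) ->
  lo (A k) (tau k) < hi (A i) (tau i) -> hi (A i) (tau i) < hi (A j) (tau j) ->
  hi (A j) (tau j) < hi (A k) (tau k) -> contains_induced e F0.
Proof.
move=> iltn jn kn nij nik njk h1 h2 h3 h4 h5.
pose a x := if x is 0%N then A i else if x is 1%N then A j else A k.
apply: (contains_split Hsym Hirr Hclq Hind (a := a)) => /=.
- by case=> [|[|[|?]]] //= _; apply: (cyC H).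
- by case=> [|[|[|?]]]; case=> [|[|[|?]]].
- move=> y y'; case: y => [|[|[|[|[|y]]]]]; case: y' => [|[|[|[|[|y']]]]] h;
    first [by exists 0%N | by exists 1%N | by exists 2%N | by exfalso; move: h; clear; lia].
move=> y y5.
suff [x hx] : exists x, [&& covers i x == (y \in [:: 0; 2; 3]%N),
     covers j x == (y \in [:: 0; 3; 4]%N) & covers k x == (y \in [:: 0; 1; 4]%N)].
  case/and3P: hx => /eqP e1 /eqP e2 /eqP e3.
  have [c cC hc] : exists2 c, c \in C & forall j, (j < n)%N -> e c (A j) = covers j x.
    have [h|[h|h]] : covers i x \/ covers j x \/ covers k x.
    - by rewrite e1 e2 e3; move: y y5 {e1 e2 e3}; do 5 (case=> //; auto).
    - exact: line_vertex h.
    - exact: line_vertex h.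
    exact: line_vertex h.
  by exists c => //; case=> [|[|[|?]]] //= _; rewrite hc.
case: y y5 => [|[|[|[|[|//]]]]] _.
- by exists (lo (A k) (tau k) + 1); rewrite /covers !inE /=; lia.
- by exists (hi (A j) (tau j) + 1); rewrite /covers !inE /=; lia.
- by exists (lo (A i) (tau i) + 1); rewrite /covers !inE /=; lia.
- by exists (lo (A j) (tau j) + 1); rewrite /covers !inE /=; lia.
- by exists (hi (A i) (tau i) + 1); rewrite /covers !inE /=; lia.
Qed.

Lemma contains_F0 : n = 3%N -> contains_induced e F0.
Proof.
move=> n3; have := overlap_last; rewrite n3 => /(_ isT) /=.
have := cystep H 0; have := cystep H 1.
have d01 : A 0%N != A 1%N by apply: (cydist H); lia.
have d02 : A 0%N != A 2%N by apply: (cydist H); lia.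
have d12 : A 1%N != A 2%N by apply: (cydist H); lia.
have d10 := d01; have d20 := d02; have d21 := d12.
rewrite eq_sym in d10; rewrite eq_sym in d20; rewrite eq_sym in d21.
rewrite /overlap => o1 o2 o3.
have [h|[h|[h|[h|[h|h]]]]] :
 (lo (A 0%N) (tau 0%N) < lo (A 1%N) (tau 1%N) < lo (A 2%N) (tau 2%N)) \/
 (lo (A 0%N) (tau 0%N) < lo (A 2%N) (tau 2%N) < lo (A 1%N) (tau 1%N)) \/
 (lo (A 1%N) (tau 1%N) < lo (A 0%N) (tau 0%N) < lo (A 2%N) (tau 2%N)) \/
 (lo (A 1%N) (tau 1%N) < lo (A 2%N) (tau 2%N) < lo (A 0%N) (tau 0%N)) \/
 (lo (A 2%N) (tau 2%N) < lo (A 0%N) (tau 0%N) < lo (A 1%N) (tau 1%N)) \/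
 (lo (A 2%N) (tau 2%N) < lo (A 1%N) (tau 1%N) < lo (A 0%N) (tau 0%N)) by lia.
- by apply: (@contains_F0_of 0 1 2); rewrite ?n3 //; lia.
- by apply: (@contains_F0_of 0 2 1); rewrite ?n3 //; lia.
- by apply: (@contains_F0_of 1 0 2); rewrite ?n3 //; lia.
- by apply: (@contains_F0_of 1 2 0); rewrite ?n3 //; lia.
- by apply: (@contains_F0_of 2 0 1); rewrite ?n3 //; lia.
- by apply: (@contains_F0_of 2 1 0); rewrite ?n3 //; lia.
Qed.

Lemma cyA_mul k d : A (k + d * n) = A k.
Proof. by elim: d => [|d IH]; rewrite ?addn0 // mulSn addnCA addnC (cyA H). Qed.

Lemma cyt_mul k d : tau (k + d * n) = tau k.
Proof.
by elim: d => [|d IH]; rewrite ?addn0 // mulSn addnCA addnC (cyt H) t0 Z.add_0_r.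
Qed.

Lemma nestedb_nr i j : nestedb i (j + n) = nestedb i j.
Proof. by rewrite /nestedb (cyA H) (cyt H) t0 Z.add_0_r. Qed.

Lemma nestedb_nl i j : nestedb (i + n) j = nestedb i j.
Proof. by rewrite /nestedb (cyA H) (cyt H) t0 Z.add_0_r. Qed.

Lemma nestedb_nested i j : nestedb i j <-> nested (A i) (tau i) (A j) (tau j).
Proof. by rewrite /nestedb /nested; lia. Qed.

(** Nesting spreads along the cycle in both directions up to the neighbours of [A j]. *)
Lemma nestedb_all i i' j : nestedb i j -> (j.+1 < i)%N -> (i.+1 < j + n)%N ->
  (j.+1 < i')%N -> (i'.+1 < j + n)%N -> nestedb i' j.
Proof.
move=> S a1 a2 b1 b2; have [le|lt] := leqP i i'.
  rewrite -nestedb_nr; apply/nestedb_nested; apply: (@trap_up i); try lia.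
  by apply/nestedb_nested; rewrite nestedb_nr.
apply/nestedb_nested; apply: (@trap_down _ (i - i')); rewrite ?subnKC; try lia.
by apply/nestedb_nested.
Qed.

Lemma covers_nestedb i j x : (i.+1 < j)%N -> (j.+1 < i + n)%N -> covers i x -> covers j x ->
  nestedb i j \/ nestedb j i.
Proof.
rewrite /covers => a b h1 h2.
have h1' : lo (A i) (tau i) < x <= hi (A i) (tau i) by lia.
have h2' : lo (A j) (tau j) < x <= hi (A j) (tau j) by lia.
case: (common_point (i := i) (j := j) _ _ h1' h2'); try lia.
by rewrite !nestedb_nested => -[_ [_]]; auto.
Qed.

Lemma argmin (f : nat -> Z) N : exists2 i, (i <= N)%N & forall k, (k <= N)%N -> f i <= f k.
Proof.
elim: N => [|N [i iN hi']].
  by exists 0%N => // k; rewrite leqn0 => /eqP ->; lia.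
have [h|h] : f i <= f N.+1 \/ f N.+1 < f i by lia.
  exists i; first by lia.
  move=> k; rewrite leq_eqVlt => /orP[/eqP -> //|]; exact: hi'.
exists N.+1 => // k; rewrite leq_eqVlt => /orP[/eqP ->|/hi']; lia.
Qed.

(** Both neighbours of the arc that starts leftmost contain its right end. They are not consecutive,
    so sharing a point makes them nested. *)
Lemma exists_big : (3 < n)%N ->
  exists i j, [/\ nestedb i j, (j.+1 < i)%N & (i.+1 < j + n)%N].
Proof.
move=> n3; have [i iN imin] := argmin (fun i => lo (A i) (tau i)) n.-1.
have {}imin k : lo (A i) (tau i) <= lo (A k) (tau k).
  rewrite (divn_eq k n) addnC cyA_mul cyt_mul; apply: imin.
  by have := ltn_pmod k (ltn_trans (isT : (0 < 3)%N) n3); lia.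
pose k := (i + n.-1)%N; have kE : k.+1 = (i + n)%N by rewrite /k; lia.
have O1 := cystep H k; have O2 := cystep H k.+1.
have m1 := imin k; have m2 := imin k.+2.
rewrite kE (cyA H) (cyt H) t0 Z.add_0_r -kE in O1 O2.
have x1 : covers k (hi (A i) (tau i)) by move: O1 m1; rewrite /overlap /covers; lia.
have x2 : covers k.+2 (hi (A i) (tau i)) by move: O2 m2; rewrite /overlap /covers; lia.
have [S|S] : nestedb k k.+2 \/ nestedb k.+2 k by apply: covers_nestedb x1 x2; lia.
  by exists (k + n)%N, k.+2; split; [rewrite nestedb_nl | lia | lia].
by exists k.+2, k; split; [ | lia | lia].
Qed.

(** By [nestedb_all], [nestedb j.+2 j] says that [A j] contains all arcs not next to it. Two such
    arcs not next to each other are the same interval, so a neighbour of one that is not next to the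
    other overlaps it. *)
Lemma big_adjacent j j' : (4 < n)%N -> nestedb j.+2 j -> nestedb j'.+2 j' ->
  (j.+1 < j')%N -> (j'.+1 < j + n)%N -> False.
Proof.
move=> n5 b b' h h'.
have S1 : nestedb j' j by apply: nestedb_all b _ _ _ _; lia.
have S2 : nestedb j j' by rewrite -nestedb_nl; apply: nestedb_all b' _ _ _ _; lia.
(* If [j' = j.+2], the arc after [A j] is next to both, and the arc before [A j] is used. *)
have [E|ne] := eqVneq j' j.+2; last first.
  apply: (cynon H (i := j.+1) (j := j') (p := tau j.+1) (q := tau j')); try lia.
  by have := cystep H j; move: S1 S2; rewrite /nestedb /overlap; lia.
apply: (cynon H (i := j') (j := (j + n).-1) (p := tau j') (q := tau (j + n).-1)); try lia.
have := cystep H (j + n).-1; rewrite prednK ?(cyA H) ?(cyt H) ?t0; last by lia.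
by rewrite Z.add_0_r; move: S1 S2; rewrite /nestedb /overlap; lia.
Qed.

Lemma contains_F1_big : (4 < n)%N -> nestedb 2 0 -> nestedb 3 1 -> contains_induced e (F1 n).
Proof.
move=> n5 b0 b1; apply: contains_F1 => //.
- by move=> i h1 h2; apply: nestedb_all b0 _ _ _ _; lia.
- by move=> i h1 h2; apply: nestedb_all b1 _ _ _ _; lia.
move=> i j x i1 ij jn mi mj.
have [S|S] : nestedb i j \/ nestedb j i by apply: covers_nestedb mi mj; lia.
  have bj : nestedb j.+2 j by rewrite -nestedb_nl in S; apply: nestedb_all S _ _ _ _; lia.
  have [E|lt] : j.+1 = n \/ (j.+1 < n)%N by lia.
    by apply: (big_adjacent n5 b1 bj); lia.
  by apply: (big_adjacent n5 b0 bj); lia.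
have bi : nestedb i.+2 i by apply: nestedb_all S _ _ _ _; lia.
by apply: (big_adjacent n5 b0 bi); lia.
Qed.

(** If two non-consecutive arcs other than [A 0] met, one would contain all its non-neighbours. By
    [big_adjacent] it would be next to [A 0], and both neighbours of [A 0] are excluded. *)
Lemma contains_F2_big : (4 < n)%N -> nestedb 2 0 -> ~~ nestedb 3 1 -> ~~ nestedb n.+1 n.-1 ->
  contains_induced e (F2 n).
Proof.
move=> n5 b0 /negP b1 /negP b2; apply: contains_F2 => //.
  by move=> i h1 h2; apply: nestedb_all b0 _ _ _ _; lia.
move=> i j x i1 ij jn mi mj.
have [S|S] : nestedb i j \/ nestedb j i by apply: covers_nestedb mi mj; lia.
  have bj : nestedb j.+2 j by rewrite -nestedb_nl in S; apply: nestedb_all S _ _ _ _; lia.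
  have [E|lt] : j.+1 = n \/ (j.+1 < n)%N by lia.
    by apply: b2; rewrite -E.
  by apply: (big_adjacent n5 b0 bj); lia.
have bi : nestedb i.+2 i by apply: nestedb_all S _ _ _ _; lia.
have [E|lt] : i = 1%N \/ (1 < i)%N by lia.
  by apply: b1; rewrite -E.
by apply: (big_adjacent n5 b0 bi); lia.
Qed.

End Fixed.

Section Unbalanced.
Variables (n : nat) (A : nat -> T) (tau : nat -> Z) (t : Z).
Hypothesis H : cyc n A tau t.
Variables (e : rel T) (idx : T -> Z).
Hypotheses (Hsym : symmetric e) (Hirr : irreflexive e)
  (Hclq : {in C &, forall x y, x != y -> e x y})
  (Hind : forall x y, x \notin C -> y \notin C -> ~~ e x y)
  (Hnb : forall a c, a \notin C -> c \in C ->
     (e c a <-> exists q, lo a q < idx c <= hi a q))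
  (Hsurj : forall x, 0 < m -> exists2 c, c \in C & exists q, x = idx c + q * m).

Lemma unbalanced_contains : (2 < n)%N -> Z.odd t = ~~ odd n ->
  contains_induced e F0
   \/ (exists k, (4 <= k)%N /\ ~~ odd k /\ contains_induced e (even_sun k))
   \/ (exists k, (5 <= k)%N /\ odd k /\ contains_induced e (F1 k))
   \/ (exists k, (5 <= k)%N /\ odd k /\ contains_induced e (F2 k)).
Proof.
move=> n3 tn; have tsmall := winding_small H n3.
case nodd : (odd n) tn => /= tn; last first.
  right; left; exists n; split; first by lia.
  split; first by rewrite nodd.
  apply: (contains_sun H Hsym Hirr Hclq Hind Hnb Hsurj) => //; first by rewrite nodd.
  by move=> E; rewrite E in tn.
have t0 : t = 0.
  by have [E|[E|//]] : t = 1 \/ t = -1 \/ t = 0; [lia | rewrite E in tn | rewrite E in tn].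
have [E|n5] : n = 3%N \/ (4 < n)%N by lia.
  by left; apply: (contains_F0 H Hsym Hirr Hclq Hind Hnb Hsurj).
have [i [j [S h1 h2]]] := exists_big H t0 (ltn_trans (isT : (3 < 4)%N) n5).
have b : nestedb A tau j.+2 j by apply: (nestedb_all H t0 S); lia.
have Hj := cyc_shift j H.
right; right.
have [b1|b1] := boolP (nestedb A tau (3 + j) (1 + j)).
  left; exists n; split=> //; split=> //.
  by apply: (contains_F1_big Hj Hsym Hirr Hclq Hind Hnb Hsurj).
have [b2|b2] := boolP (nestedb A tau (n.+1 + j) (n.-1 + j)).
  left; exists n; split=> //; split=> //.
  (* Here the arc before [A j] is the second large one; the cycle is renumbered to start with it. *)
  have Hk := cyc_shift (n.-1 + j) H.
  apply: (contains_F1_big Hk Hsym Hirr Hclq Hind Hnb Hsurj) => //.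
    suff: nestedb A tau (2 + (n.-1 + j)) (n.-1 + j) by [].
    by have -> : (2 + (n.-1 + j) = n.+1 + j)%N by lia.
  suff: nestedb A tau (3 + (n.-1 + j)) (1 + (n.-1 + j)) by [].
  have -> : (3 + (n.-1 + j) = j.+2 + n)%N by lia.
  have -> : (1 + (n.-1 + j) = j + n)%N by lia.
  by rewrite (nestedb_nl H t0) (nestedb_nr H t0).
right; exists n; split=> //; split=> //.
by apply: (contains_F2_big Hj Hsym Hirr Hclq Hind Hnb Hsurj).
Qed.

End Unbalanced.
End Cycle.

(** * The parity constraints and their shortest obstruction *)

Section Dichotomy.
Local Open Scope Z_scope.
Variables (T : finType) (e : rel T) (C : {set T}) (idx : T -> nat)
  (wrap : T -> bool) (l r : T -> nat).
Hypotheses (Hsym : symmetric e) (Hirr : irreflexive e)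
  (Hclq : {in C &, forall x y, x != y -> e x y})
  (Hind : forall x y, x \notin C -> y \notin C -> ~~ e x y)
  (HM : split_model e C idx wrap l r).

Let m := Z.of_nat #|C|.
(** A wrapping arc runs from [r a] through the cut to [m + l a]. *)
Let u a := if wrap a then Z.of_nat (r a) else Z.of_nat (l a).
Let v a := if wrap a then m + Z.of_nat (l a) else Z.of_nat (r a).
Local Notation ov := (overlap m u v).

Let len a : a \notin C -> u a <= v a <= u a + m.
Proof.
move=> aC; have := sm_ends HM aC; have := sm_wrap HM aC; rewrite /u /v /m.
by case: (wrap a) => [/(_ isT)|_]; lia.
Qed.

Let ov_range a b d : a \notin C -> b \notin C -> ov a 0 b d -> -1 <= d <= 1.
Proof.
move=> aC bC; have := sm_ends HM aC; have := sm_ends HM bC.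
have := sm_wrap HM aC; have := sm_wrap HM bC; rewrite /overlap /lo /hi /u /v.
have m0 : 0 <= m by rewrite /m; lia.
have [h|[h|//]] : 2 <= d \/ d <= -2 \/ -1 <= d <= 1 by lia.
  have hd : d * m >= 2 * m by clear -h m0; nia.
  by move: hd; rewrite /m; case: (wrap a); case: (wrap b); clear; lia.
have hd : d * m <= - 2 * m by clear -h m0; nia.
by move: hd; rewrite /m; case: (wrap a); case: (wrap b); clear; lia.
Qed.

(** Overlapping in two lifts means overlapping at both ends, which [sm_inner] and [sm_meet]
    exclude. *)
Let ov_unique a b d d' : a \notin C -> b \notin C -> ov a 0 b d -> ov a 0 b d' -> d = d'.
Proof.
move=> aC bC o o'; have h := ov_range aC bC o; have h' := ov_range aC bC o'.
have hd : d = -1 \/ d = 0 \/ d = 1 by clear -h; lia.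
have hd' : d' = -1 \/ d' = 0 \/ d' = 1 by clear -h'; lia.
move: o o' {h h'}; have := sm_ends HM aC; have := sm_ends HM bC.
have := sm_wrap HM aC; have := sm_wrap HM bC; rewrite /overlap /lo /hi /u /v /m.
have := sm_inner HM aC bC; have := sm_inner HM bC aC.
have := sm_meet HM aC bC; have := sm_meet HM bC aC.
by case: hd => [|[|]] ->; case: hd' => [|[|]] ->;
  case: (wrap a); case: (wrap b); clear; lia.
Qed.

Let nodouble a b p q q' : a \notin C -> b \notin C -> ov a p b q -> ov a p b q' -> q = q'.
Proof.
move=> aC bC o o'; have := @ov_unique a b (q - p) (q' - p) aC bC.
have := overlap_shift (- p) o; have := overlap_shift (- p) o'.
rewrite Z.add_opp_diag_r -!Z.sub_opp_r Z.opp_involutive => h h' /(_ h' h); lia.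
Qed.

Let ovb a b d : bool :=
  [|| [&& lo m u a 0 <? lo m u b d, lo m u b d <? hi m v a 0 & hi m v a 0 <? hi m v b d] |
      [&& lo m u b d <? lo m u a 0, lo m u a 0 <? hi m v b d & hi m v b d <? hi m v a 0]].

Let ovbP a b d : ovb a b d <-> ov a 0 b d.
Proof. by rewrite /ovb /overlap; lia. Qed.

Let anti (X : T * bool) := (X.1, ~~ X.2).

(* (a, s) stands for the chord of a lifted by s half-turns in the double cover
   of the circle; a step joins X to Y when X crosses the other lift of Y, so
   that choosing X forces choosing Y. *)
Let step (X Y : T * bool) :=
  [&& X.1 \notin C, Y.1 \notin C &
      if X.2 == Y.2 then ovb X.1 Y.1 1 || ovb X.1 Y.1 (-1) else ovb X.1 Y.1 0].

Let antiK : involutive anti.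
Proof. by case=> a s; rewrite /anti /= negbK. Qed.

Let step_anti X Y : step (anti X) (anti Y) = step X Y.
Proof. by rewrite /step /anti /= (inj_eq negb_inj). Qed.

Let step_sym : symmetric step.
Proof.
move=> X Y; rewrite /step [Y.2 == _]eq_sym.
have E a b d : ovb a b d = ovb b a (- d).
  by apply/idP/idP => /ovbP h; apply/ovbP; move: h; rewrite /overlap /lo /hi; lia.
rewrite (E Y.1 X.1 1) (E Y.1 X.1 (-1)) (E Y.1 X.1 0) /= orbC.
by rewrite [ovb _ _ (-1) || _]orbC andbCA.
Qed.

(** The shift on the line made by a step: 0 when the half-turns of [X] and [Y] differ, odd when they
    agree. *)
Let dir (X Y : T * bool) : Z :=
  if X.2 == Y.2 then (if ovb X.1 Y.1 1 then 1 else -1) else 0.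

Let dir_anti X Y : dir (anti X) (anti Y) = dir X Y.
Proof. by rewrite /dir /anti /= (inj_eq negb_inj). Qed.

Let dirP X Y : step X Y -> ov X.1 0 Y.1 (dir X Y).
Proof.
case/and3P => _ _; rewrite /dir; case: eqP => _; last by move/ovbP.
by case: ifP => [/ovbP //|_] /= /ovbP.
Qed.

Let dir_odd X Y : Z.odd (dir X Y) = ~~ (X.2 (+) Y.2).
Proof.
rewrite /dir; case: X => a s; case: Y => b s' /=.
by case: (ovb a b 1); case: s; case: s'.
Qed.

Let ov_step a b d s : a \notin C -> b \notin C -> ov a 0 b d ->
  exists s', step (a, s) (b, s').
Proof.
move=> aC bC o; have h := ov_range aC bC o.
have [E|[E|E]] : d = 0 \/ d = 1 \/ d = -1 by lia.
- exists (~~ s); rewrite /step aC bC /=; have -> : (s == ~~ s) = false by case: s.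
  by apply/ovbP; rewrite E in o.
- by exists s; rewrite /step aC bC /= eqxx; apply/orP; left; apply/ovbP; rewrite E in o.
by exists s; rewrite /step aC bC /= eqxx; apply/orP; right; apply/ovbP; rewrite E in o.
Qed.

(** Chosen lifts that cross come from an overlap whose shift has the parity of [s a (+) s b]. *)
Let cross_step s a b : a \notin C -> b \notin C ->
  (chord_start C wrap l r s a < chord_start C wrap l r s b < chord_end C wrap l r s a)%N /\
  (chord_end C wrap l r s a < chord_end C wrap l r s b)%N ->
  step (a, s a) (b, ~~ s b).
Proof.
move=> aC bC; rewrite /step aC bC /= /chord_start /chord_end.
have := sm_ends HM aC; have := sm_ends HM bC.
have := sm_wrap HM aC; have := sm_wrap HM bC.
have := sm_meet HM aC bC; have := sm_meet HM bC aC.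
have -> : (s a == ~~ s b) = (s a (+) s b) by case: (s a); case: (s b).
rewrite /ovb /lo /hi /u /v /m.
case: (wrap a); case: (wrap b); case: (s a); case: (s b); rewrite [_ (+) _]/=;
case: (l a =P r a) => _; case: (l b =P r b) => _; clear; lia.
Qed.

(** [anti] pairs off the connected components without fixing any. Choosing one in each pair gives a
    selection constant along steps, hence chords that do not cross. *)
Lemma balanced_two_representable :
  (forall X, X.1 \notin C -> ~~ connect step X (anti X)) -> k_representable e 2.
Proof.
move=> bal; have csym := sym_connect_sym step_sym.
(* The component whose root has the smaller rank is chosen. *)
pose sel X := (enum_rank (root step X) < enum_rank (root step (anti X)))%N.
have selN X : X.1 \notin C -> sel (anti X) = ~~ sel X.
  move=> XC; rewrite /sel antiK -leqNgt [RHS]leq_eqVlt.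
  case: eqP => //= E; case/negP: (bal X XC).
  by rewrite -(root_connect csym); apply/eqP/enum_rank_inj/val_inj; rewrite /= E.
have sel_step X Y : step X Y -> sel X = sel Y.
  move=> XY; have c : connect step X Y by apply: connect1.
  have c' : connect step (anti X) (anti Y) by apply: connect1; rewrite step_anti.
  rewrite -(root_connect csym) in c; rewrite -(root_connect csym) in c'.
  by rewrite /sel (eqP c) (eqP c').
pose s a := sel (a, true).
have sP a : a \notin C -> sel (a, s a) /\ ~~ sel (a, ~~ s a).
  move=> aC; have := selN (a, true) aC; rewrite /anti /= => E.
  by rewrite /s; case h: (sel (a, true)); rewrite /= ?E h.
apply: (two_representable (s := s) Hsym Hclq Hind HM) => a b aC bC cr.
have := sel_step _ _ (cross_step aC bC cr).
by have [-> _] := sP a aC; have [_ /negbTE ->] := sP b bC.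
Qed.

Fixpoint partial_sum (f : nat -> Z) i : Z :=
  if i is j.+1 then partial_sum f j + f j else 0.

Lemma partial_sum_periodic f n : (forall i, f (i + n)%N = f i) ->
  forall i, partial_sum f (i + n) = partial_sum f i + partial_sum f n.
Proof. by move=> fp; elim=> [|i IH] /=; rewrite ?add0n // fp IH; lia. Qed.

(** A shortest path from some [X] to [anti X] is continued by antiperiodicity. Minimality makes its
    arcs distinct and lets only consecutive ones overlap. *)
Lemma unbalanced_cycle X0 p0 : path step X0 p0 -> last X0 p0 = anti X0 ->
  exists n A tau t, [/\ cyc C m u v n A tau t, (2 < n)%N & Z.odd t = ~~ odd n].
Proof.
pose P n := [exists X, [exists p : n.-tuple (T * bool),
               path step X p && (last X p == anti X)]].
have PI X p : path step X p -> last X p = anti X -> P (size p).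
  move=> h1 h2; apply/existsP; exists X; apply/existsP; exists (in_tuple p).
  by rewrite h1 h2 /=.
move=> h1 h2; have exP : exists n, P n by exists (size p0); apply: PI h1 h2.
case: (ex_minnP exP) => n /existsP[X /existsP[p /andP[pX /eqP lX]]] nmin {h1 h2 exP X0 p0}.
have {}nmin Y q : path step Y q -> last Y q = anti Y -> (n <= size q)%N.
  by move=> h1 h2; apply: nmin; apply: PI h1 h2.
have n0 : (0 < n)%N.
  case: n p pX lX nmin => // p; rewrite tuple0 /= => _ /(congr1 snd) /=.
  by case: X.2.
pose W i := nth X (X :: p) i.
have W0 : W 0%N = X by [].
have Wn : W n = anti X by rewrite -lX (last_nth X) size_tuple.
have Wstep i : (i < n)%N -> step (W i) (W i.+1).
  by move=> lt; move/(pathP X): pX; apply; rewrite size_tuple.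
(* The path is repeated, with [anti] applied on every other round. *)
pose Y i := if odd (i %/ n) then anti (W (i %% n)%N) else W (i %% n)%N.
have Yn i : Y (i + n)%N = anti (Y i).
  rewrite /Y divnDr ?dvdnn // divnn n0 modnDr oddD /= addbT.
  by case: (odd _); rewrite /= ?antiK.
have Ystep i : step (Y i) (Y i.+1).
  suff: step (W (i %% n)%N) (if odd (i %/ n) then anti (Y i.+1) else Y i.+1).
    by rewrite /Y; case: (odd (i %/ n)) => //; rewrite -step_anti antiK.
  have lt := ltn_pmod i n0.
  suff -> : (if odd (i %/ n) then anti (Y i.+1) else Y i.+1) = W (i %% n).+1%N.
    exact: Wstep.
  have [E|lt'] : (i %% n).+1 = n \/ ((i %% n).+1 < n)%N by lia.
    have -> : i.+1 = ((i %/ n).+1 * n)%N by rewrite {1}(divn_eq i n) -addnS E mulSn addnC.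
    rewrite /Y mulnK // modnMl /= E Wn W0.
    by case: (odd _); rewrite /= ?antiK.
  have E : i.+1 = (i %/ n * n + (i %% n).+1)%N by rewrite addnS -divn_eq.
  rewrite /Y E divnMDl // (divn_small lt') addn0 modnMDl (modn_small lt').
  by case: (odd _); rewrite /= ?antiK.
have walk i d : path step (Y i) [seq Y j | j <- iota i.+1 d] /\
                last (Y i) [seq Y j | j <- iota i.+1 d] = Y (i + d)%N.
  elim: d i => [|d IH] i /=; first by rewrite addn0.
  by rewrite Ystep /=; have [-> ->] := IH i.+1; rewrite addnS.
have YC i : (Y i).1 \notin C by case/and3P: (Ystep i).
pose f i := dir (Y i) (Y i.+1).
have fper i : f (i + n)%N = f i by rewrite /f -addSn !Yn dir_anti.
have H : cyc C m u v n (fun i => (Y i).1) (partial_sum f) (partial_sum f n).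
  split=> //.
  - by move=> i; rewrite Yn.
  - exact: partial_sum_periodic.
  - move=> i; have := overlap_shift (partial_sum f i) (dirP (Ystep i)).
    by rewrite Z.add_0_l [dir _ _ + _]Z.add_comm.
  - move=> i j ij ji; apply/eqP => E.
    (* If [Y j = Y i], the walk from [j] to [i + n] is a shorter path; if [Y j = anti (Y i)], the
       walk from [i] to [j] is. *)
    have [E'|E'] : Y j = Y i \/ Y j = anti (Y i).
      by move: E; rewrite /anti; case: (Y j) (Y i) => [a []] [b []] /= ->; auto.
      have [w1 w2] := walk j (i + n - j)%N.
      have := nmin _ _ w1; rewrite w2 subnKC ?(ltnW ji) // Yn E' => /(_ erefl).
      by rewrite size_map size_iota; lia.
    have [w1 w2] := walk i (j - i)%N.
    have := nmin _ _ w1; rewrite w2 subnKC ?(ltnW ij) // E' => /(_ erefl).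
    by rewrite size_map size_iota; lia.
  move=> i j a b ij ji o.
  have o' := overlap_shift (- a) o; rewrite Z.add_opp_diag_r in o'.
  have [s' st] := ov_step (Y i).2 (YC i) (YC j) o'.
  rewrite -surjective_pairing in st.
  (* A chord shortens the walk: step from [Y i] to [Y j] and go on to [i + n], or walk from [i] to
     [j] and step to [anti (Y i)]. *)
  have [E|E] : ((Y j).1, s') = Y j \/ ((Y j).1, s') = anti (Y j).
    by rewrite /anti; case: (Y j) => c [] /=; case: s' {st}; auto.
    have [w1 w2] := walk j (i + n - j)%N; rewrite E in st.
    have := nmin (Y i) (Y j :: [seq Y k | k <- iota j.+1 (i + n - j)]).
    rewrite /= st w1 w2 subnKC; last by lia.
    by rewrite Yn => /(_ isT erefl); rewrite size_map size_iota; lia.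
  rewrite E -step_anti antiK step_sym in st.
  have [w1 w2] := walk i (j - i)%N.
  have := nmin (Y i) (rcons [seq Y k | k <- iota i.+1 (j - i)] (anti (Y i))).
  rewrite rcons_path w1 w2 last_rcons subnKC; last by lia.
  by rewrite st => /(_ isT erefl); rewrite size_rcons size_map size_iota; lia.
(* A step is odd exactly when it keeps the half-turn; over [n] steps the half-turn changes. *)
have todd i : Z.odd (partial_sum f i) = (Y i).2 (+) (Y 0%N).2 (+) odd i.
  elim: i => [|i IH] /=; first by case: (Y 0%N).2.
  rewrite Z.odd_add IH /f dir_odd.
  by case: (Y i).2; case: (Y 0%N).2; case: (odd i); case: (Y i.+1).2.
have tn : Z.odd (partial_sum f n) = ~~ odd n.
  by rewrite todd -{1}(add0n n) Yn /=; case: (Y 0%N).2; case: (odd n).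
exists n, (fun i => (Y i).1), (partial_sum f), (partial_sum f n); split=> //.
(* An arc does not overlap itself in the same lift. For [n = 2] both steps are overlaps of the same
   two arcs, so [nodouble] makes the total 0, against its parity. *)
have [E|[E|//]] : n = 1%N \/ n = 2%N \/ (2 < n)%N by lia.
  have := dirP (Ystep 0%N); have -> : Y 1%N = anti (Y 0%N) by rewrite -Yn E.
  rewrite /dir /=; have -> : ((Y 0%N).2 == ~~ (Y 0%N).2) = false by case: (Y 0%N).2.
  by rewrite /overlap; lia.
have O1 := cystep H 0; have O2 := cystep H 1.
have O3 := nodouble (YC 0%N) (YC 1%N) O1.
move: O2; have -> : (Y 2%N).1 = (Y 0%N).1 by rewrite -{1}(add0n 2%N) -{1}E Yn.
have -> : partial_sum f 2 = partial_sum f n by rewrite E.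
move/overlap_sym => O2.
have := overlap_shift (- partial_sum f n) O2; rewrite Z.add_opp_diag_r => O4.
have E0 := O3 _ O4; have : partial_sum f n = 0 by move: E0; clear; lia.
by move=> E2; move: tn; rewrite E2 E.
Qed.

Theorem two_representable_or_contains :
  k_representable e 2 \/
  (contains_induced e F0
   \/ (exists k, (4 <= k)%N /\ ~~ odd k /\ contains_induced e (even_sun k))
   \/ (exists k, (5 <= k)%N /\ odd k /\ contains_induced e (F1 k))
   \/ (exists k, (5 <= k)%N /\ odd k /\ contains_induced e (F2 k))).
Proof.
have [|bal] := boolP [exists X : T * bool, (X.1 \notin C) && connect step X (anti X)].
  case/existsP => X /andP[_ /connectP[p pX lX]]; right.
  have [n [A [tau [t [H n3 tn]]]]] := unbalanced_cycle pX (esym lX).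
  apply: (unbalanced_contains len nodouble H (idx := fun c => Z.of_nat (idx c))) n3 tn => //.
  - move=> a c aC cC; rewrite Hsym.
    have := sm_ends HM aC; have := sm_idx HM cC; rewrite /lo /hi /u /v.
    case wa: (wrap a).
      have [w1 w2] := sm_wrap HM aC wa; rewrite (sm_nb1 HM aC cC wa) => h1 h2.
      split=> [/orP[h|h]|[q hq]].
      + by exists (-1); rewrite /m; lia.
      + by exists 0; rewrite /m; lia.
      have [h|[h|h]] : q <= -1 \/ 0 <= q <= 0 \/ 1 <= q by lia.
      + by have : q * m <= - m; [rewrite /m; nia | move: hq; rewrite /m; lia].
      + have E : q = 0 by lia.
        by move: hq; rewrite E; lia.
      + by have : m <= q * m; [rewrite /m; nia | move: hq; rewrite /m; lia].
    rewrite (sm_nb0 HM aC cC wa) => h1 h2.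
    split=> [h|[q hq]]; first by exists 0; lia.
    have [h|[h|h]] : q <= -1 \/ 0 <= q <= 0 \/ 1 <= q by lia.
    + by have : q * m <= - m; [rewrite /m; nia | move: hq; rewrite /m; lia].
    + have E : q = 0 by lia.
      by move: hq; rewrite E; lia.
    + by have : m <= q * m; [rewrite /m; nia | move: hq; rewrite /m; lia].
  (* Indices run from 1 to [m], hence the shift by one around the remainder. *)
  move=> x m0; have h := Z.mod_pos_bound (x - 1) m m0; have := Z.div_mod (x - 1) m.
  have [|c cC ic] := index_surj (sm_idx HM) (sm_inj HM)
    (k := (Z.to_nat ((x - 1) mod m)).+1).
    by move: h; generalize ((x - 1) mod m) => y; rewrite /m; lia.
  by move=> dm; exists c => //; exists ((x - 1) / m); rewrite ic; lia.
left; apply: balanced_two_representable => X XC.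
by move/existsPn: bal => /(_ X); rewrite XC.
Qed.

End Dichotomy.

(** * The graphs of the family are not 2-representable *)

Section ArcModel.
Local Open Scope Z_scope.

Lemma Z_even_or_odd z : exists y, z = 2 * y \/ z = 2 * y + 1.
Proof.
exists (z / 2); have := Z.div_mod z 2; have := Z.mod_pos_bound z 2 ltac:(lia); lia.
Qed.

(* On a circle with 2k marks, the i-th clique vertex is the diameter joining the
   marks iota i and iota i + k, and the j-th independent vertex is the chord
   cutting off the marks of [U j, V j). *)
Record arc_model (k : nat) (nbs : seq (seq nat)) (iota : nat -> Z) (U V : nat -> Z) : Prop :=
    ArcModel {
  am_len : forall j, (j < size nbs)%N -> 0 <= V j - U j <= Z.of_nat k;
  am_nb : forall i j, (i < k)%N -> (j < size nbs)%N ->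
     (i \in nth [::] nbs j <-> exists z, U j <= iota i + z * Z.of_nat k < V j);
  am_nocross : forall j j' z, (j < size nbs)%N -> (j' < size nbs)%N -> j <> j' ->
     ~ (U j < U j' + 2 * z * Z.of_nat k /\ U j' + 2 * z * Z.of_nat k < V j /\
        V j < V j' + 2 * z * Z.of_nat k);
  am_inj : forall i i' z, (i < k)%N -> (i' < k)%N -> iota i + z * Z.of_nat k = iota i' -> i = i';
  am_surj : forall n, exists i z, (i < k)%N /\ n = iota i + z * Z.of_nat k }.

(** The reflection of [n] to [- 1 - n] turns [[U, V)] into [[- V, - U)]. It lets the marks of a
    first pair be assumed in a given order. *)
Lemma arc_model_mirror k nbs iota U V : arc_model k nbs iota U V ->
  arc_model k nbs (fun i => - 1 - iota i) (fun j => - V j) (fun j => - U j).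
Proof.
case=> len nb nc inj surj; split.
- by move=> j /len; lia.
- move=> i j ik js; rewrite nb //.
  by split=> -[z hz]; exists (- z); lia.
- move=> j j' z js j's ne h; apply: (nc j' j z j's js); first by auto.
  by lia.
- by move=> i i' z ik i'k h; apply: (inj i i' (- z) ik i'k); lia.
move=> n; have [i [z [ik E]]] := surj (- 1 - n); exists i, (- z); split=> //; lia.
Qed.

Section Model.
Variables (k : nat) (nbs : seq (seq nat)) (iota U V : nat -> Z).
Hypothesis HM : arc_model k nbs iota U V.
Let m := Z.of_nat k.

Definition at_mark (n : Z) (i : nat) := exists z, n = iota i + z * Z.of_nat k.

Lemma at_mark_inj n n' i i' z : (i < k)%N -> (i' < k)%N ->
  at_mark n i -> at_mark n' i' -> n' = n + z * m -> i = i'.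
Proof.
move=> ik i'k [a ->] [b ->] E; apply: (am_inj HM (z := a + z - b) ik i'k).
by move: E; rewrite /m; lia.
Qed.

Lemma at_mark_eq n n' i : at_mark n i -> at_mark n' i -> exists z, n' = n + z * m.
Proof. by move=> [a ->] [b ->]; exists (b - a); rewrite /m; lia. Qed.

Lemma at_mark_uniq n i i' : (i < k)%N -> (i' < k)%N -> at_mark n i -> at_mark n i' -> i = i'.
Proof. by move=> ik i'k h h'; apply: (at_mark_inj (z := 0) ik i'k h h'); lia. Qed.

Definition pair_arc (u v : Z) (y y' : nat) :=
  forall i, (i < k)%N -> (i = y \/ i = y' <-> exists z, u <= iota i + z * m < v).

(** As [2 < k], three successive marks belong to different vertices, so an arc with two vertices
    covers exactly two marks. *)
Lemma pair_arc_marks u v y y' : (2 < k)%N -> (y < k)%N -> (y' < k)%N -> y <> y' ->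
  0 <= v - u -> pair_arc u v y y' ->
  v = u + 2 /\ ((at_mark u y /\ at_mark (u + 1) y') \/ (at_mark u y' /\ at_mark (u + 1) y)).
Proof.
move=> k3 yk y'k ne uv P.
have on n i : (i < k)%N -> at_mark n i -> u <= n < v -> i = y \/ i = y'.
  by move=> ik [z ->] h; apply/P => //; exists z.
have [zy hy] : exists z, u <= iota y + z * m < v by apply/P; auto.
have [zy' hy'] : exists z, u <= iota y' + z * m < v by apply/P; auto.
have nE : iota y + zy * m <> iota y' + zy' * m.
  by move=> E; apply: ne; apply: (am_inj HM (z := zy - zy') yk y'k); rewrite -/m; lia.
have [i0 [z0 [i0k E0]]] := am_surj HM u.
have [i1 [z1 [i1k E1]]] := am_surj HM (u + 1).
have a0 : at_mark u i0 by exists z0.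
have a1 : at_mark (u + 1) i1 by exists z1.
have m3 : 3 <= m by rewrite /m; lia.
have mult d z : d = z * m -> -m < d < m -> z = 0 by move=> E h; nia.
have n01 : i0 <> i1.
  move=> E; rewrite E in a0; have [z hz] := at_mark_eq a0 a1.
  by have := mult 1 z; lia.
have h0 := on _ _ i0k a0; have h1 := on _ _ i1k a1.
have E : v = u + 2.
  have [//|lt] : v = u + 2 \/ u + 2 < v by lia.
  have [i2 [z2 [i2k E2]]] := am_surj HM (u + 2).
  have a2 : at_mark (u + 2) i2 by exists z2.
  have h2 := on _ _ i2k a2.
  have n02 : i0 <> i2.
    move=> E; rewrite E in a0; have [z hz] := at_mark_eq a0 a2.
    by have := mult 2 z; lia.
  have n12 : i1 <> i2.
    move=> E; rewrite E in a1; have [z hz] := at_mark_eq a1 a2.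
    by have := mult 1 z; lia.
  by lia.
split=> //.
have {}h0 : i0 = y \/ i0 = y' by apply: h0; lia.
have {}h1 : i1 = y \/ i1 = y' by apply: h1; lia.
case: h0 => E3; case: h1 => E4; try (by exfalso; lia).
  by left; rewrite -E3 -E4.
by right; rewrite -E3 -E4.
Qed.

(** The orientation is passed on: the mark before that of [y'] belongs to [y], so [y''] must come
    after [y']. *)
Lemma next_pair_arc n u v y y' y'' : (2 < k)%N ->
  (y < k)%N -> (y' < k)%N -> (y'' < k)%N -> y <> y' -> y <> y'' -> y' <> y'' ->
  at_mark n y -> at_mark (n + 1) y' -> 0 <= v - u -> pair_arc u v y' y'' ->
  [/\ v = u + 2, at_mark u y', at_mark (u + 1) y'' & exists z, u = n + 1 + z * m].
Proof.
move=> k3 yk y'k y''k d1 d2 d3 a a' uv P.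
have [E [[b b']|[b b']]] := pair_arc_marks k3 y'k y''k d3 uv P.
  by split=> //; apply: at_mark_eq b.
have [z hz] := at_mark_eq a' b'.
by case: d2; apply: (at_mark_inj (z := z) yk y''k a b); lia.
Qed.

Lemma nbs_pair_arc j y y' : (j < size nbs)%N ->
  (forall i, (i < k)%N -> (i \in nth [::] nbs j) = (i == y) || (i == y')) ->
  pair_arc (U j) (V j) y y'.
Proof.
move=> js E i ik; rewrite -(am_nb HM ik js) E //.
by split=> [[->|->]|/orP[/eqP|/eqP]]; rewrite ?eqxx ?orbT; auto.
Qed.

(* Arcs of consecutive pairs share a residue modulo k, so they would cross unless
   they are shifted by an odd multiple of k. *)
Lemma path_arcs base L : (2 < k)%N -> (L < k)%N -> (base + L <= size nbs)%N ->
  (forall j i, (j < L)%N -> (i < k)%N ->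
     (i \in nth [::] nbs (base + j)) = (i == j) || (i == j.+1)) ->
  at_mark (U base) 0 -> forall j, (j < L)%N ->
  [/\ V (base + j)%N = U (base + j)%N + 2, at_mark (U (base + j)%N) j,
      at_mark (U (base + j)%N + 1) j.+1 &
      exists z, U (base + j)%N = U base + Z.of_nat j + (2 * z + Z.of_nat j) * m].
Proof.
move=> k3 Lk bs nbE a0; elim=> [|j IH] jL.
  have P := nbs_pair_arc (j := (base + 0)%N) ltac:(lia) (fun i => nbE 0%N i jL).
  have := am_len HM (j := (base + 0)%N) ltac:(lia).
  rewrite addn0 in P * => ln.
  have [E [[b b']|[b b']]] := pair_arc_marks (y := 0%N) (y' := 1%N) k3 ltac:(lia) ltac:(lia)
      ltac:(lia) (proj1 ln) P.
    by split=> //; exists 0; lia.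
  by have := at_mark_uniq (i := 0) (i' := 1) ltac:(lia) ltac:(lia) a0 b.
have [E a a' [z Ez]] := IH (ltnW jL).
have P := nbs_pair_arc (j := (base + j.+1)%N) ltac:(lia) (fun i => nbE j.+1 i jL).
have ln := am_len HM (j := (base + j.+1)%N) ltac:(lia).
have [E' b b' [z' Ez']] := next_pair_arc (y := j) (y' := j.+1) (y'' := j.+2) k3 ltac:(lia)
    ltac:(lia) ltac:(lia)
  ltac:(lia) ltac:(lia) ltac:(lia) a a' (proj1 ln) P.
split=> //.
have [y [hy|hy]] := Z_even_or_odd z'.
  exfalso; apply: (am_nocross HM (j := (base + j)%N) (j' := (base + j.+1)%N) (z := - y)); by
      move: Ez'; rewrite hy; lia.
exists (z + y); rewrite Ez' Ez hy (_ : Z.of_nat j.+1 = Z.of_nat j + 1); last by lia.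
by ring.
Qed.

(** An arc missing a vertex lies between two successive marks of it, the first being the last one
    before [u]. *)
Lemma window u v n i : 0 < m -> at_mark n i -> ~ (exists z, u <= iota i + z * m < v) ->
  exists s, n + s * m < u /\ v <= n + s * m + m.
Proof.
move=> m0 [z0 ->] h; pose z := (u - 1 - iota i) / m; exists (z - z0).
have E := Z.div_mod (u - 1 - iota i) m; have b := Z.mod_pos_bound (u - 1 - iota i) m m0.
have h1 : iota i + z * m < u by rewrite /z; lia.
have h2 : u <= iota i + z * m + m by rewrite /z; lia.
rewrite -/m; split; first by lia.
have [|lt] : v <= iota i + z * m + m \/ iota i + z * m + m < v by lia.
  by lia.
by case: h; exists (z + 1); lia.
Qed.

(** Such a window contains only one mark of each other vertex. *)
Lemma window_mark u v p n c i w : at_mark n i -> n = p + c + w * m -> 0 < c < m ->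
  p < u -> v <= p + m -> (exists z, u <= iota i + z * m < v) -> u <= p + c < v.
Proof.
move=> [a ->] E cm pu vp [z hz]; rewrite -/m in E.
have [//|ne] : u <= p + c < v \/ ~ (u <= p + c < v) by lia.
have F : iota i + z * m = p + c + (z + w - a) * m by lia.
have : z + w - a = 0 by nia.
by move=> G; rewrite G in F; lia.
Qed.

(** Serves [F0], where the complements of the neighbourhoods are pairs. *)
Lemma complement_arc u v i : 0 < m -> (i < k)%N -> 0 <= v - u <= m ->
  (~ (exists z, u <= iota i + z * m < v)) <-> (exists z, v <= iota i + z * m < u + m).
Proof.
move=> m0 ik uv; split=> [h|[z hz] [z' hz']].
  have a : at_mark (iota i) i by exists 0; lia.
  have [s [h1 h2]] := window m0 a h.
  have [lt|ge] : iota i + s * m + m < u + m \/ u + m <= iota i + s * m + m by lia.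
    by exists (s + 1); lia.
  by lia.
have E : 0 < (z - z') * m < m by lia.
move: (z - z') E m0 => w; clear => E m0.
have [h|h] : w <= 0 \/ 1 <= w by lia.
  by nia.
by nia.
Qed.

End Model.

(** Each of the [k] arcs advances to the next by 1 plus an odd multiple of [k]. The advances add up
    to 0, so 1 plus a sum of [k] odd numbers vanishes, which is impossible for even [k]. *)
Lemma sun_no_model k iota U V : (3 < k)%N -> ~~ odd k ->
  arc_model k (sun_nbs k) iota U V -> False.
Proof.
move=> k4 ke.
have sz : size (sun_nbs k) = k by rewrite size_map size_iota.
have nthE j : (j < k)%N -> nth [::] (sun_nbs k) j = [:: j; (j.+1 %% k)%N].
  by move=> jn; rewrite (nth_map 0%N) ?size_iota // nth_iota.
suff G iota' U' V' : arc_model k (sun_nbs k) iota' U' V' -> at_mark k iota' (U' 0%N) 0 -> False.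
  move=> HM; have P := nbs_pair_arc HM (j := 0) (y := 0%N) (y' := 1%N) ltac:(lia).
  have {}P : pair_arc k iota (U 0%N) (V 0%N) 0 1.
    by apply: P => i ik; rewrite nthE ?modn_small ?inE //; lia.
  have ln := am_len HM (j := 0%N) ltac:(lia).
  have [E [[b _]|[_ [z b]]]] := pair_arc_marks HM (y := 0%N) (y' := 1%N) ltac:(lia) ltac:(lia)
      ltac:(lia) ltac:(lia) (proj1 ln) P.
    exact: G HM b.
  by apply: G (arc_model_mirror HM) _; exists (- z); lia.
move=> {U V iota}HM a0.
have H := path_arcs HM (base := 0) (L := k.-1) ltac:(lia) ltac:(lia) ltac:(lia) _ a0.
have [|E a a' [z Ez]] := H _ k.-2 ltac:(lia).
  by move=> j i jL ik; rewrite nthE ?modn_small ?inE //; lia.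
rewrite add0n in E a a' Ez.
have Pn : pair_arc k iota' (U' k.-1) (V' k.-1) k.-1 0.
  apply: (nbs_pair_arc HM); first by lia.
  by move=> i ik; rewrite nthE ?prednK ?modnn ?inE //; lia.
have ln := am_len HM (j := k.-1) ltac:(lia).
rewrite (_ : k.-2.+1 = k.-1) in a'; last by lia.
have [En b b' [z1 Ez1]] := next_pair_arc HM (y := k.-2) (y' := k.-1) (y'' := 0%N) ltac:(lia)
    ltac:(lia) ltac:(lia) ltac:(lia)
  ltac:(lia) ltac:(lia) ltac:(lia) a a' (proj1 ln) Pn.
have P0 : pair_arc k iota' (U' 0%N) (V' 0%N) 0 1.
  apply: (nbs_pair_arc HM); first by lia.
  by move=> i ik; rewrite nthE ?modn_small ?inE //; lia.
have ln0 := am_len HM (j := 0%N) ltac:(lia).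
have [E0 _ _ [z2 Ez2]] := next_pair_arc HM (y := k.-1) (y' := 0%N) (y'' := 1%N) ltac:(lia)
    ltac:(lia) ltac:(lia) ltac:(lia)
  ltac:(lia) ltac:(lia) ltac:(lia) b b' (proj1 ln0) P0.
have odd_shift j j' zz : (j < k)%N -> (j' < k)%N -> j <> j' -> V' j = U' j + 2 ->
    V' j' = U' j' + 2 -> U' j' = U' j + 1 + zz * Z.of_nat k -> exists y, zz = 2 * y + 1.
  move=> jk j'k ne e1 e2 eU; have [y [h|h]] := Z_even_or_odd zz; last by exists y.
  exfalso; apply: (am_nocross HM (j := j) (j' := j') (z := - y)); by move: eU; rewrite h; lia.
have [y1 hy1] := odd_shift k.-2 k.-1 z1 ltac:(lia) ltac:(lia) ltac:(lia) E En Ez1.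
have [y2 hy2] := odd_shift k.-1 0%N z2 ltac:(lia) ltac:(lia) ltac:(lia) En E0 Ez2.
have [h hk] : exists h, Z.of_nat k = 2 * h by exists (Z.of_nat k./2); lia.
have : (1 + (2 * z + Z.of_nat k - 2 + z1 + z2)) * Z.of_nat k = 0.
  by move: Ez Ez1 Ez2; rewrite (_ : Z.of_nat k.-2 = Z.of_nat k - 2); lia.
by move/Z.mul_eq_0 => [|]; lia.
Qed.

(** The vertex [b] misses only the two end vertices of the path, so its arc is determined up to a
    multiple [s] of [m]. For even [s] it crosses the first arc of the path and for odd [s] the last,
    as these two are an odd multiple of [m] out of step. *)
Lemma F2_no_model k iota U V : (4 < k)%N -> odd k ->
  arc_model k (F2_nbs k) iota U V -> False.
Proof.
move=> k5 ko.
have nth0 : nth [::] (F2_nbs k) 0 = seq.iota 1 (k - 2) by [].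
have nthS j : (j.+1 < k)%N -> nth [::] (F2_nbs k) j.+1 = [:: j; j.+1].
  by move=> jn; rewrite /= (nth_map 0%N) ?size_iota ?nth_iota //; lia.
have sz : size (F2_nbs k) = k by rewrite /= size_map size_iota; lia.
suff G iota' U' V' : arc_model k (F2_nbs k) iota' U' V' -> at_mark k iota' (U' 1%N) 0 -> False.
  move=> HM; have P := nbs_pair_arc HM (j := 1) (y := 0%N) (y' := 1%N) ltac:(lia).
  have {}P : pair_arc k iota (U 1%N) (V 1%N) 0 1.
    by apply: P => i ik; rewrite nthS ?inE //; lia.
  have ln := am_len HM (j := 1%N) ltac:(lia).
  have [E [[b _]|[_ [z b]]]] := pair_arc_marks HM (y := 0%N) (y' := 1%N) ltac:(lia) ltac:(lia)
      ltac:(lia) ltac:(lia) (proj1 ln) P.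
    exact: G HM b.
  by apply: G (arc_model_mirror HM) _; exists (- z); lia.
move=> {U V iota}HM a0.
have nbE j i : (j < k.-1)%N -> (i < k)%N ->
    (i \in nth [::] (F2_nbs k) (1 + j)) = (i == j) || (i == j.+1).
  by move=> jk ik; rewrite nthS ?inE //; lia.
have H := path_arcs HM (base := 1) (L := k.-1) ltac:(lia) ltac:(lia) ltac:(lia) nbE a0.
have [E0 _ m1 _] := H 0%N ltac:(lia).
have [E2 m2 m3 [z Ez]] := H k.-2 ltac:(lia).
rewrite addn0 in E0 m1.
have k1 : (1 + k.-2)%N = k.-1 by lia.
have k2 : k.-2.+1 = k.-1 by lia.
rewrite k1 in E2 m2 m3 Ez; rewrite k2 in m3.
have [q hq] : exists q, Z.of_nat k = 2 * q + 1 by exists (Z.of_nat k./2); lia.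
have hk : Z.of_nat k.-2 = Z.of_nat k - 2 by lia.
set n := U' 1%N in a0 E0 m1 Ez; set m := Z.of_nat k in hq hk Ez.
have {}Ez : U' k.-1 = n + m - 2 + (2 * (z + q - 1) + 1) * m.
  by rewrite Ez hk; rewrite {2}hq; ring.
have m0 : 0 < m by rewrite /m; lia.
have inb i : (i < k)%N -> (i \in nth [::] (F2_nbs k) 0) = (0 < i < k.-1)%N.
  by move=> ik; rewrite nth0 mem_iota; lia.
have s0 : (0 < size (F2_nbs k))%N by rewrite sz; lia.
have bin i : (0 < i < k.-1)%N -> exists z, U' 0%N <= iota' i + z * Z.of_nat k < V' 0%N.
  by move=> h; apply/(am_nb HM) => //; rewrite ?inb; lia.
have bout i : (i < k)%N -> ~ (0 < i < k.-1)%N ->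
    ~ exists z, U' 0%N <= iota' i + z * Z.of_nat k < V' 0%N.
  by move=> ik h /(am_nb HM ik s0); rewrite inb.
have [s [h1 h2]] := window m0 a0 (bout 0%N ltac:(lia) ltac:(lia)).
have b1 := window_mark (p := n + s * m) (c := 1) (w := - s) m1 ltac:(rewrite -/m; lia)
    ltac:(rewrite -/m; lia) h1 h2 (bin 1%N ltac:(lia)).
have b2 := window_mark (p := n + s * m) (c := m - 2) (w := 2 * (z + q - 1) + 1 - s) m2
  ltac:(rewrite -/m; lia) ltac:(rewrite -/m; lia) h1 h2 (bin k.-2 ltac:(lia)).
rewrite -/m in h1 h2 b1 b2.
have UE : U' 0%N = n + s * m + 1 by lia.
have VE : V' 0%N = n + s * m + m - 1.
  have [//|E] : V' 0%N = n + s * m + m - 1 \/ V' 0%N = n + s * m + m by lia.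
  case: (bout k.-1 ltac:(lia) ltac:(lia)); case: m3 => w hw.
  exists (w + s - (2 * (z + q - 1) + 1)); rewrite -/m in hw *; lia.
have [y [hy|hy]] := Z_even_or_odd s; rewrite hy in UE VE.
  by apply: (am_nocross HM (j := 1%N) (j' := 0%N) (z := - y)); rewrite -/m; lia.
by apply: (am_nocross HM (j := 0%N) (j' := k.-1) (z := y - (z + q - 1))); rewrite -/m; lia.
Qed.

(** Now the first and last arcs of the path are an even multiple of [m] out of step. The arc of [b1]
    crosses the last one or that of [b2] the first one, unless both have odd shifts; then they cross
    each other. *)
Lemma F1_no_model k iota U V : (4 < k)%N -> odd k ->
  arc_model k.-1 (F1_nbs k) iota U V -> False.
Proof.
move=> k5 ko.
have nth0 : nth [::] (F1_nbs k) 0 = seq.iota 0 (k - 2) by [].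
have nth1 : nth [::] (F1_nbs k) 1 = seq.iota 1 (k - 2) by [].
have nthS j : (j.+2 < k)%N -> nth [::] (F1_nbs k) j.+2 = [:: j; j.+1].
  by move=> jn; rewrite /= (nth_map 0%N) ?size_iota ?nth_iota //; lia.
have sz : size (F1_nbs k) = k by rewrite /= size_map size_iota; lia.
suff G iota' U' V' : arc_model k.-1 (F1_nbs k) iota' U' V' ->
    at_mark k.-1 iota' (U' 2%N) 0 -> False.
  move=> HM; have P := nbs_pair_arc HM (j := 2) (y := 0%N) (y' := 1%N) ltac:(lia).
  have {}P : pair_arc k.-1 iota (U 2%N) (V 2%N) 0 1.
    by apply: P => i ik; rewrite nthS ?inE //; lia.
  have ln := am_len HM (j := 2%N) ltac:(lia).
  have [E [[b _]|[_ [z b]]]] := pair_arc_marks HM (y := 0%N) (y' := 1%N) ltac:(lia) ltac:(lia)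
      ltac:(lia) ltac:(lia) (proj1 ln) P.
    exact: G HM b.
  by apply: G (arc_model_mirror HM) _; exists (- z); lia.
move=> {U V iota}HM a0.
have nbE j i : (j < k.-2)%N -> (i < k.-1)%N ->
    (i \in nth [::] (F1_nbs k) (2 + j)) = (i == j) || (i == j.+1).
  by move=> jk ik; rewrite nthS ?inE //; lia.
have H := path_arcs HM (base := 2) (L := k.-2) ltac:(lia) ltac:(lia) ltac:(lia) nbE a0.
have [E0 _ m1 _] := H 0%N ltac:(lia).
have [E2 m2 m3 [z Ez]] := H k.-1.-2 ltac:(lia).
rewrite addn0 in E0 m1.
have k1 : (2 + k.-1.-2)%N = k.-1 by lia.
have k2 : k.-1.-2.+1 = k.-2 by lia.
rewrite k1 in E2 m2 m3 Ez; rewrite k2 in m3.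
have [q hq] : exists q, Z.of_nat k.-1 = 2 * q by exists (Z.of_nat k./2); lia.
have hk : Z.of_nat k.-1.-2 = Z.of_nat k.-1 - 2 by lia.
set n := U' 2%N in a0 E0 m1 Ez; set m := Z.of_nat k.-1 in hq hk Ez.
have {}Ez : U' k.-1 = n + m - 2 + (2 * (z + q - 1)) * m.
  by rewrite Ez hk; rewrite {2}hq; ring.
have m0 : 0 < m by rewrite /m; lia.
have m3' : 3 < m by rewrite /m; lia.
have in0 i : (i < k.-1)%N -> (i \in nth [::] (F1_nbs k) 0) = (i < k.-2)%N.
  by move=> ik; rewrite nth0 mem_iota; lia.
have in1 i : (i < k.-1)%N -> (i \in nth [::] (F1_nbs k) 1) = (0 < i)%N.
  by move=> ik; rewrite nth1 mem_iota; lia.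
have s0 : (0 < size (F1_nbs k))%N by rewrite sz; lia.
have s1 : (1 < size (F1_nbs k))%N by rewrite sz; lia.
have bin0 i : (i < k.-2)%N -> exists z, U' 0%N <= iota' i + z * Z.of_nat k.-1 < V' 0%N.
  by move=> h; apply/(am_nb HM) => //; rewrite ?in0; lia.
have bin1 i : (0 < i < k.-1)%N -> exists z, U' 1%N <= iota' i + z * Z.of_nat k.-1 < V' 1%N.
  by move=> h; apply/(am_nb HM) => //; rewrite ?in1; lia.
have bout0 : ~ exists z, U' 0%N <= iota' k.-2 + z * Z.of_nat k.-1 < V' 0%N.
  have lt : (k.-2 < k.-1)%N by lia.
  by move=> /(am_nb HM lt s0); rewrite in0 // ltnn.
have bout1 : ~ exists z, U' 1%N <= iota' 0%N + z * Z.of_nat k.-1 < V' 1%N.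
  have lt : (0 < k.-1)%N by lia.
  by move=> /(am_nb HM lt s1); rewrite in1.
have [s [h1 h2]] := window m0 m3 bout0.
have [s' [h3 h4]] := window m0 a0 bout1.
rewrite -/m in h1 h2 h3 h4; rewrite Ez in h1 h2.
(* The mark of the last vertex, which [b1] misses, is rewritten as [n - 1] plus a multiple of
   [m]. *)
pose t := 2 * (z + q - 1) + s.
have {}h1 : n - 1 + (t + 1) * m < U' 0%N by rewrite /t; lia.
have {}h2 : V' 0%N <= n - 1 + (t + 1) * m + m by rewrite /t; lia.
have c1 := window_mark (p := n - 1 + (t + 1) * m) (c := 1) (w := - (t + 1)) a0 ltac:(rewrite -/m;
    lia) ltac:(rewrite -/m; lia) h1 h2 (bin0 0%N ltac:(lia)).
have c2 := window_mark (p := n - 1 + (t + 1) * m) (c := m - 1) (w := 2 * (z + q - 1) - t - 1) m2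
  ltac:(rewrite -/m /t; lia) ltac:(rewrite -/m; lia) h1 h2 (bin0 k.-1.-2 ltac:(lia)).
have c3 := window_mark (p := n + s' * m) (c := 1) (w := - s') m1 ltac:(rewrite -/m; lia)
    ltac:(rewrite -/m; lia) h3 h4 (bin1 1%N ltac:(lia)).
have c4 := window_mark (p := n + s' * m) (c := m - 1) (w := 2 * (z + q - 1) - s') m3
  ltac:(rewrite -/m; lia) ltac:(rewrite -/m; lia) h3 h4 (bin1 k.-2 ltac:(lia)).
rewrite -/m in c1 c2 c3 c4.
have U0 : U' 0%N = n + (t + 1) * m by lia.
have V0 : V' 0%N = n + (t + 1) * m + m - 1 by lia.
have U1 : U' 1%N = n + s' * m + 1 by lia.
have V1 : V' 1%N = n + s' * m + m by lia.
have [y [hy|hy]] := Z_even_or_odd (t + 1); rewrite hy in U0 V0.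
  by apply: (am_nocross HM (j := 0%N) (j' := k.-1) (z := y - (z + q - 1))); rewrite -/m; lia.
have [y' [hy'|hy']] := Z_even_or_odd s'; rewrite hy' in U1 V1.
  by apply: (am_nocross HM (j := 2%N) (j' := 1%N) (z := - y')); rewrite -/m; lia.
by apply: (am_nocross HM (j := 0%N) (j' := 1%N) (z := y - y')); rewrite -/m; lia.
Qed.

(** The complements are the pairs of the path 4, 1, 2, 3, and all three arcs have length 3.
    Successive ones avoid crossing only if shifted by odd multiples of 5, and then the first and
    third cross. *)
Lemma F0_no_model iota U V : arc_model 5 F0_nbs iota U V -> False.
Proof.
have comp iota' U' V' j y y' : arc_model 5 F0_nbs iota' U' V' -> (j < 3)%N ->
    (forall i, (i < 5)%N -> (i \notin nth [::] F0_nbs j) = (i == y) || (i == y')) ->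
    pair_arc 5 iota' (V' j) (U' j + 5) y y'.
  move=> HM j3 h i i5; have ln := am_len HM j3.
  rewrite -(complement_arc (k := 5) iota' _ i5 ln) // -(am_nb HM i5 j3).
  split=> [h'|/negP]; last by rewrite h // => /orP[] /eqP; auto.
  by apply/negP; rewrite h //; case: h' => ->; rewrite eqxx ?orbT.
suff G iota' U' V' : arc_model 5 F0_nbs iota' U' V' -> at_mark 5 iota' (V' 0%N) 4 -> False.
  move=> HM; have ln := am_len HM (j := 0%N) isT.
  have P : pair_arc 5 iota (V 0%N) (U 0%N + 5) 4 1.
    by refine (comp _ _ _ 0%N _ _ HM isT _); case=> [|[|[|[|[|?]]]]].
  have [E [[b _]|[_ [z b]]]] := pair_arc_marks HM (u := V 0%N) (v := U 0%N + 5) (y := 4%N) (y' :=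
      1%N) isT isT isT ltac:(lia) ltac:(lia) P.
    exact: G HM b.
  by apply: G (arc_model_mirror HM) _; exists (1 - z); lia.
move=> {U V iota}HM a0.
have P0 : pair_arc 5 iota' (V' 0%N) (U' 0%N + 5) 4 1.
  by refine (comp _ _ _ 0%N _ _ HM isT _); case=> [|[|[|[|[|?]]]]].
have P1 : pair_arc 5 iota' (V' 1%N) (U' 1%N + 5) 1 2.
  by refine (comp _ _ _ 1%N _ _ HM isT _); case=> [|[|[|[|[|?]]]]].
have P2 : pair_arc 5 iota' (V' 2%N) (U' 2%N + 5) 2 3.
  by refine (comp _ _ _ 2%N _ _ HM isT _); case=> [|[|[|[|[|?]]]]].
have l0 := am_len HM (j := 0%N) isT; have l1 := am_len HM (j := 1%N) isT.
have l2 := am_len HM (j := 2%N) isT.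
have [E0 [[_ a1]|[b _]]] := pair_arc_marks HM (u := V' 0%N) (v := U' 0%N + 5) (y := 4%N) (y' :=
    1%N) isT isT isT ltac:(lia) ltac:(lia) P0; last first.
  by have := at_mark_uniq HM (i := 4) (i' := 1) isT isT a0 b.
have [E1 b1 b2 [z1 h1]] := next_pair_arc HM (u := V' 1%N) (v := U' 1%N + 5) (y := 4%N) (y' :=
    1%N) (y'' := 2%N) isT isT isT isT
  ltac:(lia) ltac:(lia) ltac:(lia) a0 a1 ltac:(lia) P1.
have [E2 c1 c2 [z2 h2]] := next_pair_arc HM (u := V' 2%N) (v := U' 2%N + 5) (y := 1%N) (y' :=
    2%N) (y'' := 3%N) isT isT isT isT
  ltac:(lia) ltac:(lia) ltac:(lia) b1 b2 ltac:(lia) P2.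
have [y1 [g1|g1]] := Z_even_or_odd z1; rewrite g1 in h1.
  by apply: (am_nocross HM (j := 0%N) (j' := 1%N) (z := - y1)) => //; lia.
have [y2 [g2|g2]] := Z_even_or_odd z2; rewrite g2 in h2.
  by apply: (am_nocross HM (j := 1%N) (j' := 2%N) (z := - y2)) => //; lia.
by apply: (am_nocross HM (j := 0%N) (j' := 2%N) (z := - y1 - y2 - 1)) => //; lia.
Qed.

End ArcModel.

(** * Arc models from two-uniform words *)

Lemma one_occurrence (T : eqType) (x : T) w : count_mem x w = 1 ->
  exists p, (forall d, nth d w p = x) /\ forall n, count_mem x (take n w) = (p < n).
Proof.
elim: w => //= y w IH; case: eqP => [->|ne] /= c.
  exists 0; split=> // -[|n] //=; rewrite eqxx.
  have : count_mem x (take n w) <= count_mem x w.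
    by rewrite -{2}(cat_take_drop n w) count_cat leq_addr.
  by lia.
have [p [h1 h2]] := IH c; exists p.+1; split=> // -[|n] //=.
by rewrite h2; move/eqP/negbTE: ne => ->.
Qed.

Lemma two_occurrences (T : eqType) (x : T) w : count_mem x w = 2 ->
  exists pq : nat * nat, [/\ pq.1 < pq.2, forall d, nth d w pq.1 = x,
    forall d, nth d w pq.2 = x &
    forall n, count_mem x (take n w) = (pq.1 < n) + (pq.2 < n)].
Proof.
elim: w => //= y w IH; case: eqP => [->|ne] /= c.
  have [p [h1 h2]] := one_occurrence (x := x) (w := w) ltac:(lia).
  by exists (0, p.+1); split=> // -[|n] //=; rewrite eqxx h2.
have [[p q] [/= h1 h2 h3 h4]] := IH c; exists (p.+1, q.+1); split=> // -[|n] //=.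
by rewrite h4; move/eqP/negbTE: ne => ->.
Qed.

Lemma two_representable_chords (T : finType) (e : rel T) : k_representable e 2 ->
  exists p q : T -> nat, [/\ forall x, p x < q x,
    forall x y, x != y -> [/\ p x <> p y, p x <> q y & q x <> q y] &
    forall x y, x != y -> (e x y <->
      (p x < p y < q x /\ q x < q y) \/ (p y < p x < q y /\ q y < q x))].
Proof.
case=> w [uw rep].
have [f hf] := fin_all_exists (fun x => two_occurrences (uw x)).
exists (fun x => (f x).1), (fun x => (f x).2).
have lt x : (f x).1 < (f x).2 by case: (hf x).
have ne x y : x != y -> [/\ (f x).1 <> (f y).1, (f x).1 <> (f y).2 & (f x).2 <> (f y).2].
  move=> /eqP xy; have [_ a1 a2 _] := hf x; have [_ b1 b2 _] := hf y.
  by split=> E; apply: xy; [rewrite -(a1 x) E b1 | rewrite -(a1 x) E b2 | rewrite -(a2 x) E b2].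
split=> // x y xy; rewrite (rep x y xy) alternate_interlaces // /interlaces.
have F a b : a != b -> (forall n, count_mem b (take n w) <= count_mem a (take n w) <=
   (count_mem b (take n w)).+1) <-> (f a).1 < (f b).1 < (f a).2 /\ (f a).2 < (f b).2.
  move=> ab; have [la _ _ ca] := hf a; have [lb _ _ cb] := hf b.
  have [n1 n2 n3] := ne _ _ ab; have [_ n4 _] : _ := ne b a ltac:(by rewrite eq_sym).
  split=> [h|h n]; last by rewrite ca cb; move: h; clear; lia.
  have := h (f a).1.+1; have := h (f b).1.+1; have := h (f a).2.+1; have := h (f b).2.+1.
  by rewrite !ca !cb; move: la lb n1 n2 n3 n4; clear; lia.
by rewrite !F // eq_sym.
Qed.

Lemma contains_split_inv (T : finType) (e : rel T) k (nbs : seq (seq nat)) :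
  0 < k -> contains_induced e (split_rel k nbs) ->
  exists c a : nat -> T,
  [/\ forall i i', i < k -> i' < k -> i != i' -> c i != c i' /\ e (c i) (c i'),
      forall j j', j < size nbs -> j' < size nbs -> j != j' -> a j != a j' /\ ~~ e (a j) (a j') &
      forall i j, i < k -> j < size nbs -> c i != a j /\ e (c i) (a j) = (i \in nth [::] nbs j)].
Proof.
move=> k0 [f [finj fE]].
pose x0 : 'I_(k + size nbs) := Ordinal (leq_trans k0 (leq_addr _ _)).
pose g n := f (odflt x0 (insub n)).
have gE n n' : n < k + size nbs -> n' < k + size nbs -> n != n' ->
    g n != g n' /\ e (g n) (g n') = split_adj k nbs n n'.
  move=> h h' ne; rewrite /g !insubT /= fE /split_rel (inj_eq finj) /=.
  by rewrite -val_eqE /= ne.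
exists g, (fun j => g (k + j)); split.
- move=> i i' ik i'k ne; have [-> ->] := gE i i' ltac:(lia) ltac:(lia) ne.
  by rewrite /split_adj ik i'k.
- move=> j j' js j's ne.
  have [|-> ->] := gE (k + j) (k + j') ltac:(lia) ltac:(lia); first by rewrite eqn_add2l.
  by rewrite /split_adj !ltnNge !leq_addr.
move=> i j ik js; have [-> ->] := gE i (k + j) ltac:(lia) ltac:(lia) ltac:(lia).
by rewrite /split_adj ik ltnNge leq_addr addKn.
Qed.

Section Ranks.
Variables (k : nat) (P Q : 'I_k -> nat).
Hypotheses (PQ : forall i j, P i < Q j) (Pinj : injective P)
  (PQ_mono : forall i j, (P i < P j) = (Q i < Q j)).

(** Clique chords cross pairwise, so all starts [P] precede all ends [Q], in the same order. This is
    the place of [t] among these [2k] marks. *)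
Definition marks_below t := #|[set i | P i < t]| + #|[set i | Q i < t]|.
Definition mark_rank i := #|[set j | P j < P i]|.

Lemma mark_rank_lt i : mark_rank i < k.
Proof.
rewrite -[X in _ < X]card_ord -cardsT; apply: proper_card; apply/properP.
by split; [apply/subsetP | exists i; rewrite ?inE ?ltnn].
Qed.

Lemma marks_below_mono t t' : t <= t' -> marks_below t <= marks_below t'.
Proof.
move=> tt'; apply: leq_add; apply: subset_leq_card; apply/subsetP => i; rewrite !inE => h;
  exact: leq_trans h tt'.
Qed.

Lemma marks_below_le t : marks_below t <= k + k.
Proof.
have h (A : {set 'I_k}) : #|A| <= k by rewrite -[X in _ <= X]card_ord max_card.
exact: leq_add.
Qed.

Lemma marks_below_start t i : P i != t -> (P i < t) = (mark_rank i < marks_below t).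
Proof.
move=> ne; apply/idP/idP => [h|].
  apply: leq_trans (leq_addr _ _); apply: proper_card; apply/properP; split.
    by apply/subsetP => j; rewrite !inE => /ltn_trans; apply.
  by exists i; rewrite !inE ?ltnn.
apply: contraTT; rewrite -leqNgt => h; rewrite -leqNgt.
have -> : marks_below t = #|[set j | P j < t]|.
  rewrite /marks_below (_ : [set j | Q j < t] = set0) ?cards0 ?addn0 //.
  by apply/setP => j; rewrite !inE; have := PQ i j; lia.
by apply: subset_leq_card; apply/subsetP => j; rewrite !inE => /leq_trans; apply.
Qed.

Lemma marks_below_end t i : Q i != t -> (Q i < t) = (mark_rank i + k < marks_below t).
Proof.
move=> ne.
have rE : mark_rank i = #|[set j | Q j < Q i]|.
  by apply: eq_card => j; rewrite !inE PQ_mono.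
apply/idP/idP => [h|].
  rewrite /marks_below addnC rE (_ : [set j | P j < t] = setT); last first.
    by apply/setP => j; rewrite !inE (ltn_trans (PQ j i)).
  rewrite cardsT card_ord ltn_add2l; apply: proper_card; apply/properP; split.
    by apply/subsetP => j; rewrite !inE => /ltn_trans; apply.
  by exists i; rewrite !inE ?ltnn.
apply: contraTT; rewrite -leqNgt => h; rewrite -leqNgt /marks_below addnC; apply: leq_add.
  by rewrite rE; apply: subset_leq_card; apply/subsetP => j; rewrite !inE => /leq_trans; apply.
by rewrite -[X in _ <= X]card_ord max_card.
Qed.

Lemma mark_rank_inj : injective mark_rank.
Proof.
move=> i j E; apply/eqP/negPn/negP => ne.
have nP x y : x != y -> P x != P y by move=> xy; apply: contraNneq xy => /Pinj ->.
wlog lt : i j E ne / P i < P j.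
  move=> W; case: (ltngtP (P i) (P j)) => [h|h|h]; first exact: (W i j).
    by apply: (W j i); rewrite // eq_sym.
  by have := nP _ _ ne; rewrite h eqxx.
have : mark_rank i < mark_rank j.
  apply: proper_card; apply/properP; split.
    by apply/subsetP => x; rewrite !inE => /ltn_trans; apply.
  by exists i; rewrite !inE ?ltnn.
by rewrite E ltnn.
Qed.

Lemma mark_rank_surj r : r < k -> exists i, mark_rank i = r.
Proof.
move=> rk; have [|||i _ h] := @index_surj _ [set: 'I_k] (fun i => (mark_rank i).+1) _ _ r.+1.
- by move=> i _; rewrite cardsT card_ord mark_rank_lt.
- by move=> i j _ _ [/mark_rank_inj].
- by rewrite cardsT card_ord.
by exists i; case: h.
Qed.

End Ranks.

Theorem arc_model_of_word (T : finType) (e : rel T) k (nbs : seq (seq nat)) :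
  0 < k -> k_representable e 2 -> contains_induced e (split_rel k nbs) ->
  exists iota U V, arc_model k nbs iota U V.
Proof.
move=> k0 /two_representable_chords [p [q [pq ne pqE]]] /(contains_split_inv k0) [c [a [cc aa ca]]].
pose P (i : 'I_k) := p (c i); pose Q (i : 'I_k) := q (c i).
have clq (i j : 'I_k) : i != j -> (P i < P j < Q i /\ Q i < Q j) \/ (P j < P i < Q j /\ Q j < Q i).
  by move=> ij; have [h1 h2] := cc i j (ltn_ord i) (ltn_ord j) ij; apply/pqE.
have PQ i j : P i < Q j.
  have [->|ij] := eqVneq i j; first exact: pq.
  by have := clq i j ij; lia.
have Pinj : injective P.
  move=> i j E; apply/eqP/negPn/negP => ij; have [h1 _] := cc i j (ltn_ord i) (ltn_ord j) ij.
  by have [] := ne _ _ h1.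
have PQm i j : (P i < P j) = (Q i < Q j).
  have [->|ij] := eqVneq i j; first by rewrite !ltnn.
  by have := clq i j ij; lia.
pose i0 := Ordinal k0; pose iota i := mark_rank P (odflt i0 (insub i)).
pose g j := marks_below P Q (p (a j)); pose h j := marks_below P Q (q (a j)).
have iotaE i (ik : i < k) : iota i = mark_rank P (Ordinal ik) by rewrite /iota insubT.
have iota_lt i : iota i < k by apply: mark_rank_lt.
have gh j : g j <= h j <= k + k by rewrite /g /h marks_below_mono ?marks_below_le // ltnW.
have ends i j : i < k -> j < size nbs ->
    [/\ (p (c i) < p (a j)) = (iota i < g j), (q (c i) < p (a j)) = (iota i + k < g j),
        (p (c i) < q (a j)) = (iota i < h j) & (q (c i) < q (a j)) = (iota i + k < h j)].
  move=> ik js; have [d _] := ca i j ik js; have [n1 n2 n3] := ne _ _ d.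
  have [_ n4 _] : _ := ne (a j) (c i) ltac:(by rewrite eq_sym).
  rewrite !iotaE /g /h.
  have nq : q (c i) <> p (a j) by move=> E; apply: n4.
  have f1 t := @marks_below_start _ P Q PQ t (Ordinal ik); have f2 t := @marks_below_end _ P Q PQ
      PQm t (Ordinal ik).
  by rewrite /P /Q /= in f1 f2; split; [apply: f1 | apply: f2 | apply: f1 | apply: f2]; apply/eqP.
(* Of the two sides of the chord, the one with at most [k] marks is kept; the other choice is
   [[h j, g j + 2k)]. *)
pose small j := h j - g j <= k.
pose U j := Z.of_nat (if small j then g j else h j).
pose V j := Z.of_nat (if small j then h j else g j + k + k).
exists (fun i => Z.of_nat (iota i)), U, V; split.
- move=> j js; rewrite /U /V; have := gh j; case E: (small j); move: E; rewrite /small; lia.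
- move=> i j ik js; have [d <-] := ca i j ik js; have [e1 e2 e3 e4] := ends i j ik js.
  have [n1 n2 n3] := ne _ _ d; have [_ n4 _] : _ := ne (a j) (c i) ltac:(by rewrite eq_sym).
  have lt := iota_lt i; have gj := gh j; rewrite pqE //.
  have m1 := PQ (Ordinal ik) (Ordinal ik); rewrite /P /Q /= in m1.
  have m2 := pq (a j).
  have E : (p (c i) < p (a j) < q (c i) /\ q (c i) < q (a j)) \/
           (p (a j) < p (c i) < q (a j) /\ q (a j) < q (c i)) <->
           (iota i < g j <= iota i + k /\ iota i + k < h j) \/
           (g j <= iota i < h j /\ h j <= iota i + k).
    rewrite (leqNgt (g j) (iota i + k)) (leqNgt (g j) (iota i)) (leqNgt (h j)) -e2 -e4 -e3 -e1.
    by move: m1 m2 n1 n2 n3 n4; clear; lia.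
  rewrite E /U /V /small; move: lt gj; clear => lt gj; split=> [H|[z hz]].
    (* The diameter has ends [iota i] and [iota i + k]; [z = 2] is the first end one full turn
       later. *)
    case: (leqP (h j - g j) k) => s; case: H => H; [exists 1%Z | exists 0%Z | exists 2%Z | exists
        1%Z]; lia.
  have [zn|[zb|zp]] : (z <= -1 \/ (z = 0 \/ z = 1 \/ z = 2 \/ z = 3) \/ 4 <= z)%Z by lia.
  + have : (z * Z.of_nat k <= - Z.of_nat k)%Z by nia.
    by move: hz; case: (leqP (h j - g j) k) => s; lia.
  + by move: hz; case: (leqP (h j - g j) k) => s; case: zb => [|[|[|]]] ->; lia.
  + have : (z * Z.of_nat k >= 4 * Z.of_nat k)%Z by nia.
    by move: hz; case: (leqP (h j - g j) k) => s; lia.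
- move=> j j' z js j's jj'; have [|d nadj] := aa j j' js j's; first by apply/eqP.
  (* Strict inequalities between numbers of marks lift to positions in the word, so a crossing of
     arcs would join two independent vertices. *)
  have nc : ~ (g j < g j' < h j /\ h j < h j') /\ ~ (g j' < g j < h j' /\ h j' < h j).
    have lift t t' : marks_below P Q t < marks_below P Q t' -> t < t'.
      by rewrite ltnNge => /negP n; rewrite ltnNge; apply/negP => /(marks_below_mono P Q).
    split=> -[/andP[/lift h1 /lift h2] /lift h3]; case/negP: nadj; apply/(pqE _ _ d).
      by left; rewrite h1 h2.
    by right; rewrite h1 h2.
  have gj := gh j; have gj' := gh j'; rewrite /U /V /small.
  move: nc gj gj'; clear => nc gj gj' hz.
  have [zn|[zb|zp]] : (z <= -2 \/ (z = -1 \/ z = 0 \/ z = 1) \/ 2 <= z)%Z by lia.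
  + have : (2 * z * Z.of_nat k <= - 4 * Z.of_nat k)%Z by nia.
    by move: hz; case: (leqP (h j - g j) k) => s; case: (leqP (h j' - g j') k) => s'; lia.
  + by move: hz; case: (leqP (h j - g j) k) => s; case: (leqP (h j' - g j') k) => s'; case: zb =>
      [|[|]] ->; lia.
  + have : (2 * z * Z.of_nat k >= 4 * Z.of_nat k)%Z by nia.
    by move: hz; case: (leqP (h j - g j) k) => s; case: (leqP (h j' - g j') k) => s'; lia.
- move=> i i' z ik i'k E; have l1 := iota_lt i; have l2 := iota_lt i'.
  have z0 : z = 0%Z by nia.
  move: E; rewrite z0 => E; have : iota i = iota i' by lia.
  by rewrite !iotaE => /(mark_rank_inj Pinj) [].
move=> n; have K0 : (0 < Z.of_nat k)%Z by lia.
have b := Z.mod_pos_bound n (Z.of_nat k) K0; have dm := Z.div_mod n (Z.of_nat k).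
have [|i hi] := @mark_rank_surj _ P Pinj (Z.to_nat (n mod Z.of_nat k)); first by lia.
exists i, (n / Z.of_nat k)%Z; split=> //; rewrite (iotaE _ (ltn_ord i)).
have -> : Ordinal (ltn_ord i) = i by apply: val_inj.
by rewrite hi; lia.
Qed.

(** * The equivalence *)

(** In [w ++ w] both counts have grown by one when the second copy begins, so the comparison starts
    afresh. *)
Lemma one_two_representable (T : finType) (e : rel T) :
  k_representable e 1 -> k_representable e 2.
Proof.
case=> w [uw rep]; exists (w ++ w); split=> [x|a b ab].
  by rewrite count_cat uw.
rewrite (rep a b ab) !alternate_interlaces //.
have F x y : x != y -> interlaces x y w <-> interlaces x y (w ++ w).
  move=> xy.
  split=> h n; last first.
    have [lt|ge] := ltnP n (size w); first by have := h n; rewrite take_cat lt.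
    by have := h (size w); rewrite take_cat ltnn subnn take0 cats0 take_oversize.
  rewrite take_cat; case: ltnP => _; first exact: h.
  by rewrite !count_cat (uw x) (uw y) -addnS !leq_add2l; apply: h.
by rewrite !F // eq_sym.
Qed.

Theorem theorem6 (T : finType) (e : rel T)
  (Hsym : symmetric e) (Hirr : irreflexive e)
  (Hsplit : is_split e) (Hwr : word_representable e) :
  rep_number_is e 3 <->
  (contains_induced e F0
   \/ (exists k, 4 <= k /\ ~~ odd k /\ contains_induced e (even_sun k))
   \/ (exists k, 5 <= k /\ odd k /\ contains_induced e (F1 k))
   \/ (exists k, 5 <= k /\ odd k /\ contains_induced e (F2 k))).
Proof.
case: Hsplit => C [I [disj cov clq ind]].
have inI x : x \notin C -> x \in I.
  by move=> xC; have := in_setT x; rewrite -cov inE (negbTE xC).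
have Hclq : {in C &, forall x y, x != y -> e x y} by move=> x y xC yC; apply: clq.
have Hind x y : x \notin C -> y \notin C -> ~~ e x y by move=> /inI xI /inI; apply: ind.
have [idx [wrap [l [r HM]]]] := word_representable_model Hsym Hirr Hwr Hclq Hind.
split=> [[_ [_ min]]|H].
  have [two|//] := two_representable_or_contains Hsym Hirr Hclq Hind HM.
  by case: (min 2 isT).
have not2 : ~ k_representable e 2.
  move=> two; case: H => [H|[[k [k4 [ke H]]]|[[k [k5 [ko H]]]|[k [k5 [ko H]]]]]].
  - by have [iota [U [V M]]] := arc_model_of_word (k := 5) isT two H; exact: F0_no_model M.
  - have [|iota [U [V M]]] := arc_model_of_word _ two H; first by lia.
    by apply: sun_no_model M.
  - rewrite /F1 subn1 in H; have [|iota [U [V M]]] := arc_model_of_word _ two H; first by lia.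
    by apply: F1_no_model M.
  have [|iota [U [V M]]] := arc_model_of_word _ two H; first by lia.
  by apply: F2_no_model M.
split=> //; split; first exact: three_representable Hsym Hclq Hind HM.
move=> j j3; have [->|->] : j = 1 \/ j = 2 by lia.
  by move/one_two_representable.
exact: not2.
Qed.
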